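(* Let $\mathcal C$ be a cube with center $O$, and let $f\colon\mathcal C\to\mathbb{R}$ be convex on every pyramid having a face of $\mathcal C$ as base and $O$ as apex. Fix two opposite vertices $V,W$ of $\mathcal C$. Let $P$ be the union of the six face diagonals that have $V$ or $W$ as an endpoint, and let $Q$ be the union of the three main (space) diagonals of $\mathcal C$ joining the remaining six vertices. Then $$\operatorname{Avg}(f,\mathcal C)\le\frac12\operatorname{Avg}(f,P)+\frac12\operatorname{Avg}(f,Q).$$
   Context: $\operatorname{Avg}(f,\mathcal C)$ is the average over the cube with respect to volume; $\operatorname{Avg}(f,P)$ and $\operatorname{Avg}(f,Q)$ are averages over these unions of segments with respect to length. *)

(* Defs.v *)
From HB Require Import structures.
From mathcomp Require Import all_boot all_order all_algebra.
From mathcomp Require Import all_classical all_reals all_analysis.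
Set Implicit Arguments. Unset Strict Implicit. Unset Printing Implicit Defensive.
Import Order.TTheory GRing.Theory Num.Theory numFieldNormedType.Exports.
Local Open Scope classical_set_scope.
Local Open Scope ring_scope.

Section CubeDefs.
Variable R : realType.
Notation pt := 'rV[R]_3.

Definition dot (u v : pt) : R := (u *m v^T) 0 0.
Definition len (u : pt) : R := Num.sqrt (dot u u).

Definition orthonormal_frame (e : 'I_3 -> pt) : Prop :=
  forall i j, dot (e i) (e j) = (i == j)%:R.

Definition cpt (c : pt) (a : R) (e : 'I_3 -> pt) (t : 'I_3 -> R) : pt :=
  c + a *: \sum_(j < 3) t j *: e j.

Definition cube (c : pt) (a : R) (e : 'I_3 -> pt) : set pt :=
  [set cpt c a e t | t in [set t | forall j, -1 <= t j <= 1]].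

Definition sgn (b : bool) : R := if b then 1 else -1.

Definition face (c : pt) (a : R) (e : 'I_3 -> pt) (i : 'I_3) (b : bool) : set pt :=
  [set cpt c a e t | t in [set t | t i = sgn b /\ forall j, -1 <= t j <= 1]].

Definition pyramid (c : pt) (a : R) (e : 'I_3 -> pt) (i : 'I_3) (b : bool) : set pt :=
  [set y | exists (lam : R) (x : pt), 0 <= lam <= 1 /\ face c a e i b x /\
     y = c + lam *: (x - c)].

Definition convex_on (S : set pt) (f : pt -> R) : Prop :=
  forall x y lam, S x -> S y -> 0 <= lam <= 1 ->
    f (lam *: x + (1 - lam) *: y) <= lam * f x + (1 - lam) * f y.

Definition vertex (c : pt) (a : R) (e : 'I_3 -> pt) (s : {ffun 'I_3 -> bool}) : pt :=
  cpt c a e (fun j => sgn (s j)).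

Definition opp_sign (s : {ffun 'I_3 -> bool}) : {ffun 'I_3 -> bool} :=
  [ffun j => ~~ s j].

(* number of coordinates in which two vertices differ:
   2 = the vertices are the endpoints of a face diagonal,
   3 = the vertices are the endpoints of a main (space) diagonal *)
Definition hamming (s t : {ffun 'I_3 -> bool}) : nat := #|[set j | s j != t j]|.

(* Avg(f, C): volume average of f over the cube.  The cube is the image of
   [-1,1]^3 under the affine map t |-> c + a sum_j t_j e_j, whose Jacobian is
   the constant a^3 (orthonormal frame); hence
   Avg(f, C) = (1/8) int_{[-1,1]^3} f(c + a sum t_j e_j) dt. *)
Definition leb3 := ((@lebesgue_measure R \x @lebesgue_measure R) \x @lebesgue_measure R)%E.

Definition avg_cube (c : pt) (a : R) (e : 'I_3 -> pt) (f : pt -> R) : R :=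
  (1 / 8) * Rintegral leb3
    (`[-1, 1]%classic `*` `[-1, 1]%classic `*` `[-1, 1]%classic)
    (fun p => f (cpt c a e (fun j => if j == 0 :> nat then p.1.1
                                     else if j == 1 :> nat then p.1.2 else p.2))).

Definition avg_seg (f : pt -> R) (x y : pt) : R :=
  Rintegral (@lebesgue_measure R) `[0, 1]%classic (fun u => f (x + u *: (y - x))).

(* average w.r.t. length of f over a union of segments meeting only at
   endpoints, given as a list of segments: length-weighted mean *)
Definition avg_segs (f : pt -> R) (segs : seq (pt * pt)) : R :=
  (\sum_(s <- segs) len (s.2 - s.1) * avg_seg f s.1 s.2) /
  (\sum_(s <- segs) len (s.2 - s.1)).

Definition P_segs (c : pt) (a : R) (e : 'I_3 -> pt) (s0 : {ffun 'I_3 -> bool})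
  : seq (pt * pt) :=
  [seq (vertex c a e s0, vertex c a e t) | t <- enum {ffun 'I_3 -> bool} & hamming s0 t == 2]
  ++ [seq (vertex c a e (opp_sign s0), vertex c a e t)
       | t <- enum {ffun 'I_3 -> bool} & hamming (opp_sign s0) t == 2].

(* Q: the three main diagonals joining the six vertices other than V, W;
   each diagonal [vertex t, vertex (opp_sign t)] is listed once, namely for the
   endpoint t with t 0 = ~~ s0 0 *)
Definition Q_segs (c : pt) (a : R) (e : 'I_3 -> pt) (s0 : {ffun 'I_3 -> bool})
  : seq (pt * pt) :=
  [seq (vertex c a e t, vertex c a e (opp_sign t))
     | t <- enum {ffun 'I_3 -> bool}
     & (t != s0) && (t != opp_sign s0) && (t ord0 == ~~ s0 ord0)].

End CubeDefs.

(* Main.v *)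
(* Each face carries exactly one diagonal of P and, after being cut along it, splits
   into two triangles; the cones over these triangles with apex O cut the cube into
   12 tetrahedra of equal volume. In such a tetrahedron the face diagonal and the half
   of a diagonal of Q joining O to the third vertex of the triangle are opposite edges,
   and every point is s A + (1 - s) B with A on the former and B on the latter. Convexity
   gives f <= s f(A) + (1 - s) f(B); in linear coordinates (s, b, g) adapted to the two
   edges, the integral of the right-hand side is a constant times the sum of the averages
   of f over these edges. Summing over the 12 tetrahedra gives the claim.
   As f need not be measurable on the cube, only the majorant is integrated. *)
Require Import Defs.
From HB Require Import structures.
From mathcomp Require Import all_boot all_order all_algebra.
From mathcomp Require Import all_classical all_reals all_analysis.
From mathcomp Require Import measurable_realfun ring lra.
Set Implicit Arguments.
Unset Strict Implicit.
Unset Printing Implicit Defensive.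
Import Order.TTheory GRing.Theory Num.Theory numFieldNormedType.Exports.
Local Open Scope classical_set_scope.
Local Open Scope ring_scope.

(** After the coordinates are multiplied by the signs of V or of W, that vertex becomes (1, 1, 1);
    such a sign choice and a permutation of the axes carry each of the 12 tetrahedra to the model 1
    >= x >= y >= z >= -x, with vertices O, (1, 1, 1), (1, -1, -1), (1, 1, -1). One integral is
    computed there and transported by symmetry. The coordinates s = x - (y - z) / 2, b = (y - z) /
    2, g = (x - y) / 2 have Jacobian 1/4 in absolute value, and each of the two edges contributes 4
    B(3, 2) = 1/3 times its average. Every face diagonal and every half-diagonal is an edge of two
    tetrahedra, so the total factor is 1/8 * 2/3 = 1/12: one half of the weight 1/6 in a mean over
    six edges. Since [f] may be negative, a constant [M] is added until all majorants are
    nonnegative and Tonelli applies; it contributes [M] times the volume 8 and is subtracted at the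
    end. Convexity is known only inside each pyramid, so a diagonal of Q is treated as two halves
    meeting at O. *)

Section integration.
Context {R : realType}.
Local Notation mu := (@lebesgue_measure R).
Local Open Scope ereal_scope.

(** The left side is a measure that gives each interval ]a, b] its length, which characterises
    Lebesgue measure. *)
Lemma lebesgue_measure_affine (r c : R) (A : set R) : (0 < r)%R -> measurable A ->
  r%:E * pushforward mu (fun x : R => (r * x + c)%R : measurableTypeR R) A = mu A.
Proof.
move=> r0 mA.
have mf : measurable_fun [set: R] (fun x : R => (r * x + c)%R : measurableTypeR R).
  by apply: measurable_funD => //; apply: measurable_funM.
pose m := mscale (NngNum (ltW r0)) (pushforward mu (fun x : R => (r * x + c)%R : measurableTypeR R)).
rewrite -[LHS]/(m mf A); apply/esym/lebesgue_measure_unique => //= _ [[a b]] _ <-.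
rewrite /m /mscale/= /pushforward/=.
have -> : (fun x : R => r * x + c)%R @^-1` `]a, b]%classic =
   `]((a - c) / r)%R, ((b - c) / r)%R]%classic.
  apply/seteqP; split => x /=; rewrite !in_itv/= ltr_pdivrMr// ler_pdivlMr//;
  by move=> /andP[? ?]; apply/andP; split; nra.
rewrite !lebesgue_measure_itv/= !lte_fin ltr_pM2r ?invr_gt0// ltrD2r.
case: ifP => _; last by rewrite mule0.
by rewrite -!EFinD -EFinM; congr EFin; field; rewrite gt_eqF.
Qed.

Lemma integral_affine (r c : R) (h : R -> \bar R) : (0 < r)%R ->
  measurable_fun [set: R] h -> (forall x, 0 <= h x) ->
  \int[mu]_x h (r * x + c)%R = (r^-1)%:E * \int[mu]_x h x.
Proof.
move=> r0 mh h0.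
have mf : measurable_fun [set: R] (fun x : R => (r * x + c)%R : measurableTypeR R).
  by apply: measurable_funD => //; apply: measurable_funM.
pose F := (fun x : R => (r * x + c)%R : measurableTypeR R).
have -> : \int[mu]_x h (r * x + c)%R = \int[pushforward mu F]_x h x.
  by rewrite ge0_integral_pushforward//=.
have ri : (0 <= r^-1)%R by rewrite invr_ge0 ltW.
rewrite -[RHS](@ge0_integral_mscale _ _ R mu setT measurableT (NngNum ri))//.
apply: eq_measure_integral => A mA _ /=; rewrite /mscale/=.
have := @lebesgue_measure_affine r c A r0 mA => <-.
by rewrite muleA -EFinM mulVf ?gt_eqF// mul1e.
Qed.

Lemma integral_oppr (h : R -> \bar R) :
  measurable_fun [set: R] h -> (forall x, 0 <= h x) ->
  \int[mu]_x h (- x)%R = \int[mu]_x h x.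
Proof.
move=> mh h0.
have mf : measurable_fun [set: R] (fun x : R => (- x)%R : measurableTypeR R).
  exact: oppr_measurable.

pose F := (fun x : R => (- x)%R : measurableTypeR R).
have -> : \int[mu]_x h (- x)%R = \int[pushforward mu F]_x h x.
  by rewrite ge0_integral_pushforward//=.
by apply: eq_measure_integral => A mA _ /=; exact: lebesgue_measureN.
Qed.

End integration.

(** * Iterated integrals in three variables and their substitutions *)

Section triple_integral.
Context {R : realType}.
Local Notation mu := (@lebesgue_measure R).
Local Open Scope ereal_scope.
Implicit Type F : R -> R -> R -> \bar R.

Definition meas3 F :=
  measurable_fun [set: (R * R) * R] (fun p => F p.1.1 p.1.2 p.2).

Definition int3 F := \int[mu]_x \int[mu]_y \int[mu]_z F x y z.

(** The domain is arbitrary, so that the lemma serves both for changes of variables in space and for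
    freezing some of the variables. *)
Lemma meas3_comp d (T : measurableType d) F (a b c : T -> R) : meas3 F ->
  measurable_fun [set: T] a -> measurable_fun [set: T] b ->
  measurable_fun [set: T] c ->
  measurable_fun [set: T] (fun t => F (a t) (b t) (c t)).
Proof.
move=> mF ma mb mc.
apply: (measurableT_comp mF (g := fun t => ((a t, b t), c t))).
by apply/measurable_fun_pairP; split => //; apply/measurable_fun_pairP; split.
Qed.

Lemma measurable_proj11 : measurable_fun [set: (R * R) * R] (fun p => p.1.1).
Proof. exact: (measurableT_comp measurable_fst measurable_fst). Qed.

Lemma measurable_proj12 : measurable_fun [set: (R * R) * R] (fun p => p.1.2).
Proof. exact: (measurableT_comp measurable_snd measurable_fst). Qed.

Lemma measurable_proj2 : measurable_fun [set: (R * R) * R] (fun p => p.2).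
Proof. exact: measurable_snd. Qed.

Hint Resolve measurable_proj11 measurable_proj12 measurable_proj2 : core.

Lemma meas3_swap12 F : meas3 F -> meas3 (fun x y z => F y x z).
Proof.
move=> mF; exact: (meas3_comp mF measurable_proj12 measurable_proj11 measurable_proj2).
Qed.

Lemma meas3_swap23 F : meas3 F -> meas3 (fun x y z => F x z y).
Proof.
move=> mF; exact: (meas3_comp mF measurable_proj11 measurable_proj2 measurable_proj12).
Qed.

Lemma measurable_int1 F : meas3 F -> (forall x y z, 0 <= F x y z) ->
  measurable_fun [set: R * R] (fun p => \int[mu]_z F p.1 p.2 z).
Proof.
move=> mF F0.
by apply: (measurable_fun_fubini_tonelli_F (m2 := mu) (fun q => F q.1.1 q.1.2 q.2)).
Qed.

Lemma measurable_int2 F : meas3 F -> (forall x y z, 0 <= F x y z) ->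
  measurable_fun [set: R] (fun x => \int[mu]_y \int[mu]_z F x y z).
Proof.
move=> mF F0; apply: (measurable_fun_fubini_tonelli_F (m2 := mu)
  (fun p => \int[mu]_z F p.1 p.2 z)); first exact: measurable_int1.
by move=> p; exact: integral_ge0.
Qed.

Lemma sigma_finite_leb2 : sigma_finite setT (mu \x mu).
Proof.
pose I (n : nat) : set (measurableTypeR R) := `]-%R n%:R, n%:R]%classic.
exists (fun n => I n `*` I n) => [|n].
  rewrite predeqE => -[x y]; split => // _.
  pose m := (Num.bound x + Num.bound y)%N.
  exists m => //; rewrite /I; split; rewrite /= in_itv/= natrD;
    have := archi_boundP (normr_ge0 x); have := archi_boundP (normr_ge0 y);
    rewrite /Num.bound !normr_id -/(Num.bound x) -/(Num.bound y) => yb xb.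
  - have := ler_norm x; have := ler_norm (- x); have := normr_ge0 y; rewrite normrN.
    by move=> ? ? ?; apply/andP; split; lra.
  - have := ler_norm y; have := ler_norm (- y); have := normr_ge0 x; rewrite normrN.
    by move=> ? ? ?; apply/andP; split; lra.
have mI : measurable (I n) by exact: measurable_itv.
split; first exact: measurableX.
rewrite product_measure1E// lte_mul_pinfty//.
  by rewrite /= lebesgue_measure_itv/=; case: ifP.
by rewrite /= lebesgue_measure_itv/=; case: ifP => // _; rewrite -EFinB ltry.
Qed.

(* The canonical sigma-finite instance of [product_measure1] is shadowed by the
   one for pairs of probability measures, hence the explicit packing. *)
Lemma integral_leb3 F : meas3 F -> (forall x y z, 0 <= F x y z) ->
  \int[@leb3 R]_p F p.1.1 p.1.2 p.2 = int3 F.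
Proof.
move=> mF F0.
have F0' (p : R * R * R) : 0 <= F p.1.1 p.1.2 p.2 by exact: F0.
have I0 (p : R * R) : 0 <= \int[mu]_z F p.1 p.2 z by exact: integral_ge0.
pose sf := Measure_isSigmaFinite.Build _ _ _ (mu \x mu) sigma_finite_leb2.
pose m : {sigma_finite_measure set (measurableTypeR R * measurableTypeR R)%type -> \bar R} :=
  HB.pack (mu \x mu) sf.
etransitivity.
  exact: (fubini_tonelli1 (m1 := m) (m2 := mu) (fun p => F p.1.1 p.1.2 p.2) mF F0').
exact: (fubini_tonelli1 (m1 := mu) (m2 := mu) (fun p => \int[mu]_z F p.1 p.2 z) (measurable_int1 mF F0) I0).
Qed.

Lemma int3_swap12 F : meas3 F -> (forall x y z, 0 <= F x y z) ->
  int3 (fun x y z => F y x z) = int3 F.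
Proof.
move=> mF F0.
rewrite /int3 (@fubini_tonelli _ _ _ _ _ mu mu (fun p => \int[mu]_z F p.2 p.1 z))//.
  exact: (measurable_int1 (meas3_swap12 mF)).
by move=> p; exact: integral_ge0.
Qed.

Lemma int3_swap23 F : meas3 F -> (forall x y z, 0 <= F x y z) ->
  int3 (fun x y z => F x z y) = int3 F.
Proof.
move=> mF F0; apply: eq_integral => x _.
rewrite (@fubini_tonelli _ _ _ _ _ mu mu (fun p => F x p.2 p.1))//.
exact: (@meas3_comp _ (R * R)%type F (cst x) snd fst mF).
Qed.

(** The innermost integral is taken with the outer variables fixed, so the translation may depend on
    them; this is what makes shears accessible to one-variable substitution. *)
Lemma int3_affine3 F (r : R) (c : R -> R -> R) :
  meas3 F -> (forall x y z, 0 <= F x y z) -> (0 < r)%R ->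
  int3 (fun x y z => F x y (r * z + c x y)%R) = (r^-1)%:E * int3 F.
Proof.
move=> mF F0 r0; have ri : (0 <= r^-1)%R by rewrite invr_ge0 ltW.
have mz x y : measurable_fun [set: R] (F x y).
  exact: (@meas3_comp _ R F (cst x) (cst y) id mF).
have my x : measurable_fun [set: R] (fun y => \int[mu]_z F x y z).
  apply: (measurableT_comp (measurable_int1 mF F0) (g := fun y => (x, y))).
  exact: pair1_measurable.
transitivity (\int[mu]_x ((r^-1)%:E * \int[mu]_y \int[mu]_z F x y z)).
  apply: eq_integral => x _; rewrite -ge0_integralZl_EFin//.
  - by apply: eq_integral => y _; exact: integral_affine.
  - by move=> y _; exact: integral_ge0.
  - exact: my.
apply: (@ge0_integralZl_EFin _ _ _ mu setT measurableT
  (fun x => \int[mu]_y \int[mu]_z F x y z)) => //; last exact: measurable_int2.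
by move=> x _; apply: integral_ge0 => y _; exact: integral_ge0.
Qed.

Lemma int3_opp3 F : meas3 F -> (forall x y z, 0 <= F x y z) ->
  int3 (fun x y z => F x y (- z)%R) = int3 F.
Proof.
move=> mF F0; apply: eq_integral => x _; apply: eq_integral => y _.
apply: (integral_oppr (h := F x y)) => //.
exact: (@meas3_comp _ R F (cst x) (cst y) id mF).
Qed.

Lemma meas3_opp3 F : meas3 F -> meas3 (fun x y z => F x y (- z)%R).
Proof.
move=> mF; apply: (meas3_comp mF measurable_proj11 measurable_proj12).
exact: measurable_funN measurable_proj2.
Qed.

Lemma int3_opp1 F : meas3 F -> (forall x y z, 0 <= F x y z) ->
  int3 (fun x y z => F (- x)%R y z) = int3 F.
Proof.
move=> mF F0; apply: integral_oppr; first exact: measurable_int2.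
by move=> x; apply: integral_ge0 => y _; exact: integral_ge0.
Qed.

(** Conjugating with the swap of the last two variables reduces this to [int3_opp3]. *)
Lemma int3_opp2 F : meas3 F -> (forall x y z, 0 <= F x y z) ->
  int3 (fun x y z => F x (- y)%R z) = int3 F.
Proof.
move=> mF F0; have m1 := meas3_swap23 mF; have m2 := meas3_opp3 m1.
refine (etrans (int3_swap23 m2 _) _); first by [].
by refine (etrans (int3_opp3 m1 _) (int3_swap23 mF _)).
Qed.

End triple_integral.
#[global] Hint Resolve measurable_proj11 measurable_proj12 measurable_proj2 : core.

(** * The integral contributed by one edge of a tetrahedron *)

Section cone_integral.
Context {R : realType}.
Local Notation mu := (@lebesgue_measure R).

(** Weight s of the point A times the value of [p] at its parameter u on the edge, where g = s u.
    The bounds 0 <= g <= s of the tetrahedron are not tested here: they come from [p] vanishing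
    outside [0, 1]. *)
Definition cone (p : R -> R) (s b g : R) : R :=
  if [&& 0 <= s, 0 <= b & b <= 1 - s] then s * p (g / s) else 0.

Lemma cone_ge0 (p : R -> R) s b g : (forall u, 0 <= p u) -> 0 <= cone p s b g.
Proof. by rewrite /cone => p0; case: ifP => // /and3P[s0 _ _]; rewrite mulr_ge0. Qed.

(** The measurable function [powR] with exponent -1 is the inverse on nonnegative numbers; squaring
    brings every x there, and the identity persists at 0 because 0 is its own inverse. *)
Lemma measurable_invr : measurable_fun [set: R] (@GRing.inv R).
Proof.
rewrite (_ : @GRing.inv R = fun x : R => x * (x * x) `^ (-1)); last first.
  apply/funext => x; rewrite powR_inv1; last by rewrite -expr2 sqr_ge0.
  by have [->|x0] := eqVneq x 0; [rewrite !(mul0r, invr0)|rewrite invfM mulrA divff// mul1r].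
apply: measurable_funM; first exact: measurable_id.
apply: (measurableT_comp (measurable_powR (-1)) (g := fun x : R => x * x)).
by apply: measurable_funM; exact: measurable_id.
Qed.

Lemma meas3_cone (p : R -> R) : measurable_fun [set: R] p ->
  meas3 (fun s b g => (cone p s b g)%:E).
Proof.
move=> mp; apply/measurable_EFinP; rewrite /cone /=.
have m1 := @measurable_proj11 R; have m2 := @measurable_proj12 R.
have m3 := @measurable_proj2 R.
apply: measurable_fun_ifT => /=.
- apply: measurable_and; first exact: measurable_fun_ler.
  by apply: measurable_and; apply: measurable_fun_ler => //; apply: measurable_funB.
- apply: measurable_funM => //.
  apply: (measurableT_comp mp (g := fun x : R * R * R => x.2 / x.1.1)).
  by apply: measurable_funM => //; exact: (measurableT_comp measurable_invr m1).
- exact: measurable_cst.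
Qed.

Local Open Scope ereal_scope.

(** Substituting g = s u produces a second factor s beside the weight already present in [cone]. *)
Lemma integral_cone3 (p : R -> R) s b : measurable_fun [set: R] p ->
  (forall u, 0 <= p u)%R ->
  \int[mu]_g (cone p s b g)%:E =
  (\int[mu]_u (p u)%:E) * ((if 0 <= s then s ^+ 2 else 0) * \1_(`[0, 1 - s]%classic) b)%R%:E.
Proof.
move=> mp p0; rewrite /cone indicE mem_setE in_itv/=.
have [s0|s0] := leP 0%R s; last first.
  by rewrite /= mul0r mule0; exact: integral0.
case: ((0 <= b)%R && (b <= 1 - s)%R); rewrite /=; last by rewrite mulr0 mule0; exact: integral0.
rewrite mulr1; have [<-|s1] := eqVneq 0%R s.
  rewrite expr0n/= mule0; under eq_integral do rewrite mul0r.
  exact: integral0.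
have s2 : (0 < s)%R by rewrite lt_neqAle s1.
have mp' : measurable_fun [set: R] (fun u => (p u)%:E) by exact/measurable_EFinP.
have sg (g : R) : (g / s = s^-1 * g + 0)%R by rewrite addr0 mulrC.
under eq_integral => g _ do rewrite EFinM sg.
rewrite ge0_integralZl_EFin//; last 2 first.
- by move=> x _; rewrite lee_fin.
- apply: (measurableT_comp mp' (g := fun x : R => s^-1 * x + 0)%R).
  by apply: measurable_funD => //; apply: measurable_funM.
rewrite (integral_affine 0 (h := fun u => (p u)%:E)) ?invr_gt0//.
by rewrite invrK muleA -EFinM -expr2 muleC.
Qed.

(** After g and b are integrated out, s ^ 2 (1 - s) remains on [0, 1]: the Beta integral B(3, 2) =
    2! 1! / 4! = 1/12. *)
Lemma integral_cone (p : R -> R) : measurable_fun [set: R] p ->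
  (forall u, 0 <= p u)%R ->
  int3 (fun s b g => (cone p s b g)%:E) = (12^-1)%:E * \int[mu]_u (p u)%:E.
Proof.
move=> mp p0; set I := \int[mu]_u _.
have I0 : 0 <= I by apply: integral_ge0 => x _; rewrite lee_fin.
transitivity (\int[mu]_s (I * ((@XMonemX R 2 1) \_ `[0%R, 1%R] s)%:E)).
  apply: eq_integral => s _.
  under eq_integral do rewrite integral_cone3// -/I EFinM muleA.
  rewrite ge0_integralZl//; last 2 first.
  - by apply/measurable_EFinP; exact: measurable_indic.
  - by rewrite mule_ge0// lee_fin; case: ifP => // _; exact: sqr_ge0.
  rewrite integral_indic//= setIT -muleA; congr (_ * _).
  rewrite lebesgue_measure_itv/= lte_fin patchE mem_setE in_itv/=.
  rewrite /XMonemX /unstable.onem expr1.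
  case: (leP 0%R s) => s0 /=; last by rewrite mul0e.
  (* For s >= 1 the range of b has measure 0; the right-hand side vanishes too, for s > 1 by the
     restriction to [0, 1] and at s = 1 by the factor 1 - s. *)
  have [s1|s1] := ltP 0%R (1 - s)%R.
    have -> : (s <= 1)%R by lra.
    by rewrite -EFinB subr0 -EFinM.
  rewrite mule0; case: leP => //= s2; rewrite (_ : s = 1%R) ?subrr ?mulr0//; lra.
rewrite ge0_integralZl//; last 2 first.
- apply/measurable_EFinP/measurable_restrict => //; exact: measurable_XMonemX.
- by move=> x _; rewrite lee_fin patchE; case: ifP => //; rewrite mem_setE; exact: XMonemX_ge0.
have := @EFin_beta_fun R 3 2; rewrite /= => <-.
by rewrite beta_fun_fact muleC; congr (_%:E * _); rewrite -[(_ * _)%N]/2%N -[_`!]/24%N; lra.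
Qed.

End cone_integral.

(** * The integral over the model tetrahedron *)

Section tetrahedron_integral.
Context {R : realType}.
Local Notation mu := (@lebesgue_measure R).
Local Open Scope ereal_scope.

Lemma int3_reflect1 (F : R -> R -> R -> \bar R) : meas3 F ->
  (forall x y z, 0 <= F x y z) ->
  int3 (fun x y z => F (1 - x)%R y z) = int3 F.
Proof.
move=> mF F0; pose h x := \int[mu]_y \int[mu]_z F x y z.
have mh : measurable_fun [set: R] h by exact: measurable_int2.
have h0 x : 0 <= h x by apply: integral_ge0 => y _; exact: integral_ge0.
have e := @integral_affine R 1 1 h ltr01 mh h0; rewrite invr1 mul1e in e.
have mh' : measurable_fun [set: R] (fun x => h (1 * x + 1)%R).
  apply: (measurableT_comp mh (g := fun x : R => (1 * x + 1)%R)).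
  by apply: measurable_funD => //; apply: measurable_funM.
refine (etrans _ (etrans (integral_oppr mh' (fun x => h0 _)) e)).
by apply: eq_integral => x _; rewrite /h mul1r addrC.
Qed.

(* The inner variables are replaced one at a time: z by s, y by g, x by b. *)
Lemma int3_shear (H : R -> R -> R -> \bar R) : meas3 H ->
  (forall x y z, 0 <= H x y z) ->
  int3 (fun x y z => H (x + (z - y) / 2) ((y - z) / 2) ((x - y) / 2))%R = 4%:E * int3 H.
Proof.
move=> mH H0.
have m1 := @measurable_proj11 R; have m2 := @measurable_proj12 R.
have m3 := @measurable_proj2 R.
pose F1 x y s := H s (x - s)%R ((x - y) / 2)%R.
have mF1 : meas3 F1.
  apply: (meas3_comp mH) => //; first exact: measurable_funB.
  by apply: measurable_funM => //; exact: measurable_funB.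
pose F2 x s y := H s (x - s)%R (2^-1 * y + x / 2)%R.
pose F3 x s g := H s (x - s)%R g.
have mF2 : meas3 F2.
  apply: (meas3_comp mH) => //; first exact: measurable_funB.
  by apply: measurable_funD; apply: measurable_funM => //; exact: measurable_funB.
have mF3 : meas3 F3 by apply: (meas3_comp mH) => //; exact: measurable_funB.
have m4 := meas3_swap12 mF3; have m5 := meas3_swap23 m4; have m6 := meas3_swap23 mH.
have r2 : (0 < 2^-1 :> R)%R by rewrite invr_gt0.
have E1 : int3 (fun x y z => H (x + (z - y) / 2) ((y - z) / 2) ((x - y) / 2))%R
    = 2%:E * int3 F1.
  have e := int3_affine3 (fun x y => x - y / 2)%R mF1 (fun x y z => H0 _ _ _) r2.
  rewrite invrK in e; refine (etrans _ e).
  by congr int3; apply/funext => x; apply/funext => y; apply/funext => z;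
    rewrite /F1; congr H; field.
have E2 : int3 F1 = 2%:E * int3 F3.
  have e := int3_affine3 (fun x s => x / 2)%R mF3 (fun x y z => H0 _ _ _) r2.
  rewrite invrK in e; refine (etrans _ e).
  (* The variable g = (x - y) / 2 decreases in y, whereas [int3_affine3] asks for a positive factor;
     y is therefore reflected beforehand. *)
  refine (etrans _ (int3_opp3 mF2 (fun x y z => H0 _ _ _))).
  refine (etrans (esym (int3_swap23 mF1 (fun x y z => H0 _ _ _))) _).
  by congr int3; apply/funext => x; apply/funext => s; apply/funext => y;
    rewrite /F2 /F1; congr H; field.
have E3 : int3 F3 = int3 H.
  refine (etrans (esym (int3_swap12 mF3 (fun x y z => H0 _ _ _))) _).
  refine (etrans (esym (int3_swap23 m4 (fun x y z => H0 _ _ _))) _).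
  refine (etrans _ (int3_swap23 mH H0)).
  have e := int3_affine3 (fun s g => - s)%R m6 (fun x y z => H0 x z y) ltr01.
  rewrite invr1 mul1e in e; refine (etrans _ e).
  by congr int3; apply/funext => s; apply/funext => g; apply/funext => x;
    rewrite /F3 mul1r.
rewrite E1 E2 E3 muleA -EFinM; congr (_%:E * _); lra.
Qed.


Lemma int3D (F G : R -> R -> R -> \bar R) : meas3 F -> meas3 G ->
  (forall x y z, 0 <= F x y z) -> (forall x y z, 0 <= G x y z) ->
  int3 (fun x y z => F x y z + G x y z) = int3 F + int3 G.
Proof.
move=> mF mG F0 G0.
have I1 H (H0 : forall x y z : R, 0 <= H x y z) x y : 0 <= \int[mu]_z H x y z.
  exact: integral_ge0.
have I2 H (H0 : forall x y z : R, 0 <= H x y z) x : 0 <= \int[mu]_y \int[mu]_z H x y z.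
  by apply: integral_ge0 => y _; exact: I1.
have m0 H (mH : meas3 H) x y : measurable_fun [set: R] (H x y).
  exact: (@meas3_comp _ _ R H (cst x) (cst y) id mH).
have m1 H (mH : meas3 H) (H0 : forall x y z : R, 0 <= H x y z) x :
    measurable_fun [set: R] (fun y => \int[mu]_z H x y z).
  apply: (measurableT_comp (measurable_int1 mH H0) (g := fun y => (x, y))).
  exact: pair1_measurable.
rewrite /int3 -ge0_integralD//; last 4 first.
- by move=> x _; exact: I2.
- exact: measurable_int2.
- by move=> x _; exact: I2.
- exact: measurable_int2.
apply: eq_integral => x _; rewrite -ge0_integralD//; last 4 first.
- by move=> y _; exact: I1.
- exact: m1.
- by move=> y _; exact: I1.
- exact: m1.
by apply: eq_integral => y _; rewrite -ge0_integralD//; exact: m0.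
Qed.

(** The variables s, b, g solve x = s + b, y = s - 2 g + b, z = s - 2 g - b, the coordinates of the
    point with weight s on the face diagonal. Exchanging s with 1 - s and b with g exchanges the two
    edges, whence the second summand. *)
Definition tet (p q : R -> R) (x y z : R) : R :=
  (let s := x + (z - y) / 2 in let b := (y - z) / 2 in let g := (x - y) / 2 in
  cone p s b g + cone q (1 - s) g b)%R.

Section tet.
Variables p q : R -> R.
Hypotheses (mp : measurable_fun [set: R] p) (p0 : forall u, (0 <= p u)%R).
Hypotheses (mq : measurable_fun [set: R] q) (q0 : forall u, (0 <= q u)%R).

Lemma tet_ge0 x y z : (0 <= tet p q x y z)%R.
Proof. by rewrite addr_ge0// cone_ge0. Qed.

Let H s b g := (cone p s b g)%:E + (cone q (1 - s)%R g b)%:E.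

Let H0 s b g : 0 <= H s b g.
Proof. by rewrite adde_ge0// lee_fin cone_ge0. Qed.

Let mcone' : meas3 (fun s b g => (cone q (1 - s)%R g b)%:E).
Proof.
refine (meas3_comp (a := fun p : R * R * R => (1 - p.1.1)%R) (meas3_cone mq) _
  (@measurable_proj2 R) (@measurable_proj12 R)).
by apply: measurable_funB => //; exact: measurable_proj11.
Qed.

Let mH : meas3 H.
Proof. by apply: emeasurable_funD => //; exact: meas3_cone. Qed.

Lemma meas3_tet : meas3 (fun x y z => (tet p q x y z)%:E).
Proof.
have m1 := @measurable_proj11 R; have m2 := @measurable_proj12 R.
have m3 := @measurable_proj2 R.
apply: (meas3_comp mH).
- apply: measurable_funD => //; apply: measurable_funM => //; exact: measurable_funB.
- by apply: measurable_funM => //; exact: measurable_funB.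
- by apply: measurable_funM => //; exact: measurable_funB.
Qed.

Lemma int3_tet : int3 (fun x y z => (tet p q x y z)%:E) =
  3^-1%:E * (\int[mu]_u (p u)%:E + \int[mu]_u (q u)%:E).
Proof.
refine (etrans (int3_shear mH H0) _).
have c0 (r : R -> R) (r0 : forall u, (0 <= r u)%R) s b g : 0 <= (cone r s b g)%:E.
  by rewrite lee_fin cone_ge0.
rewrite int3D//; [|exact: meas3_cone|exact: c0|by move=> *; exact: c0].
(* The exchange of the two edges is measure preserving: a reflection of s and a swap of b and g. *)
have -> : int3 (fun s b g => (cone q (1 - s)%R g b)%:E) = int3 (fun s b g => (cone q s b g)%:E).
  have mc := meas3_cone mq.
  refine (etrans (int3_reflect1 (meas3_swap23 mc) _) (int3_swap23 mc _)) => *; exact: c0.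
rewrite !integral_cone// -ge0_muleDr; last 2 first.
- by apply: integral_ge0 => x _; rewrite lee_fin.
- by apply: integral_ge0 => x _; rewrite lee_fin.
by rewrite muleA -EFinM; congr (_%:E * _); lra.
Qed.

End tet.

(** * Invariance of the integral under signed permutations of the axes *)

Definition crd (p : R * R * R) (l : 'I_3) : R :=
  (if l == 0 :> nat then p.1.1 else if l == 1 :> nat then p.1.2 else p.2)%R.

Lemma measurable_crd l : measurable_fun [set: R * R * R] (crd ^~ l).
Proof.
have m1 := @measurable_proj11 R; have m2 := @measurable_proj12 R.
have m3 := @measurable_proj2 R.
by rewrite /crd; case: (l == 0 :> nat)%R; case: (l == 1 :> nat)%R.
Qed.

(** A triple (i, j, k) stands for the decreasing order of the signed coordinates: i selects the
    face, and k the vertex of the triangle off the face diagonal. An explicit list allows proofs by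
    enumeration. *)
Definition perms3 : seq ('I_3 * 'I_3 * 'I_3) :=
  let o0 : 'I_3 := Ordinal (isT : 0 < 3)%N in
  let o1 : 'I_3 := Ordinal (isT : 1 < 3)%N in
  let o2 : 'I_3 := Ordinal (isT : 2 < 3)%N in
  [:: (o0, o1, o2); (o0, o2, o1); (o1, o0, o2); (o1, o2, o0); (o2, o0, o1); (o2, o1, o0)].

(** The two swaps of neighbouring variables generate all six orders. *)
Lemma integral_leb3_perm (F : R -> R -> R -> \bar R) t :
  t \in perms3 -> meas3 F -> (forall x y z, 0 <= F x y z) ->
  \int[@leb3 R]_p F (crd p t.1.1) (crd p t.1.2) (crd p t.2) = int3 F.
Proof.
move=> tP mF F0.
have m12 := meas3_swap12 mF; have m23 := meas3_swap23 mF.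
have E12 := int3_swap12 mF F0; have E23 := int3_swap23 mF F0.
move: tP; rewrite !in_cons in_nil orbF.
move=> /orP[/eqP->|/orP[/eqP->|/orP[/eqP->|/orP[/eqP->|/orP[/eqP->|/eqP->]]]]].
- refine (etrans _ (integral_leb3 mF F0)); exact: eq_integral.
- refine (etrans _ (etrans (integral_leb3 m23 (fun _ _ _ => F0 _ _ _)) E23)).
  exact: eq_integral.
- refine (etrans _ (etrans (integral_leb3 m12 (fun _ _ _ => F0 _ _ _)) E12)).
  exact: eq_integral.
- refine (etrans _ (etrans (integral_leb3 (meas3_swap12 m23) (fun _ _ _ => F0 _ _ _))
    (etrans (int3_swap12 m23 (fun _ _ _ => F0 _ _ _)) E23))); exact: eq_integral.
- refine (etrans _ (etrans (integral_leb3 (meas3_swap23 m12) (fun _ _ _ => F0 _ _ _))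
    (etrans (int3_swap23 m12 (fun _ _ _ => F0 _ _ _)) E12))); exact: eq_integral.
- have m := meas3_swap23 m12.
  refine (etrans _ (etrans (integral_leb3 (meas3_swap12 m) (fun _ _ _ => F0 _ _ _))
    (etrans (int3_swap12 m (fun _ _ _ => F0 _ _ _))
      (etrans (int3_swap23 m12 (fun _ _ _ => F0 _ _ _)) E12)))); exact: eq_integral.
Qed.

Lemma int3_sign1 (F : R -> R -> R -> \bar R) (b : bool) :
  meas3 F -> (forall x y z, 0 <= F x y z) ->
  int3 (fun x y z => F (sgn R b * x) y z)%R = int3 F.
Proof.
move=> mF F0; case: b; last refine (etrans _ (int3_opp1 mF F0)); congr int3;
  by apply/funext => x; apply/funext => y; apply/funext => z;
     rewrite /sgn ?mul1r ?mulN1r.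
Qed.

Lemma int3_sign2 (F : R -> R -> R -> \bar R) (b : bool) :
  meas3 F -> (forall x y z, 0 <= F x y z) ->
  int3 (fun x y z => F x (sgn R b * y) z)%R = int3 F.
Proof.
move=> mF F0; case: b; last refine (etrans _ (int3_opp2 mF F0)); congr int3;
  by apply/funext => x; apply/funext => y; apply/funext => z;
     rewrite /sgn ?mul1r ?mulN1r.
Qed.

Lemma int3_sign3 (F : R -> R -> R -> \bar R) (b : bool) :
  meas3 F -> (forall x y z, 0 <= F x y z) ->
  int3 (fun x y z => F x y (sgn R b * z))%R = int3 F.
Proof.
move=> mF F0; case: b; last refine (etrans _ (int3_opp3 mF F0)); congr int3;
  by apply/funext => x; apply/funext => y; apply/funext => z;
     rewrite /sgn ?mul1r ?mulN1r.
Qed.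

Lemma int3_sign (F : R -> R -> R -> \bar R) (b1 b2 b3 : bool) :
  meas3 F -> (forall x y z, 0 <= F x y z) ->
  int3 (fun x y z => F (sgn R b1 * x) (sgn R b2 * y) (sgn R b3 * z))%R = int3 F.
Proof.
move=> mF F0.
have mM (b : bool) : measurable_fun [set: R] (fun x : R => sgn R b * x)%R.
  exact: measurable_funM.
have m1 := @measurable_proj11 R; have m2 := @measurable_proj12 R.
have m3 := @measurable_proj2 R.
pose F1 x y z := F (sgn R b1 * x)%R y z.
pose F2 x y z := F1 x (sgn R b2 * y)%R z.
have mF1 : meas3 F1 by apply: (meas3_comp mF) => //; exact: measurableT_comp (mM b1) m1.
have mF2 : meas3 F2 by apply: (meas3_comp mF1) => //; exact: measurableT_comp (mM b2) m2.
exact (etrans (int3_sign3 b3 mF2 (fun _ _ _ => F0 _ _ _))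
  (etrans (int3_sign2 b2 mF1 (fun _ _ _ => F0 _ _ _)) (int3_sign1 b1 mF F0))).
Qed.

Lemma integral_leb3_signed_perm (F : R -> R -> R -> \bar R) t
    (e : 'I_3 -> bool) :
  t \in perms3 -> meas3 F -> (forall x y z, 0 <= F x y z) ->
  \int[@leb3 R]_p F (sgn R (e t.1.1) * crd p t.1.1)%R
    (sgn R (e t.1.2) * crd p t.1.2)%R (sgn R (e t.2) * crd p t.2)%R = int3 F.
Proof.
move=> tP mF F0.
pose G x y z := F (sgn R (e t.1.1) * x)%R (sgn R (e t.1.2) * y)%R (sgn R (e t.2) * z)%R.
refine (etrans (integral_leb3_perm (F := G) tP _ (fun _ _ _ => F0 _ _ _))
  (int3_sign (e t.1.1) (e t.1.2) (e t.2) mF F0)).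
have mM (b : bool) : measurable_fun [set: R] (fun x : R => sgn R b * x)%R.
  exact: measurable_funM.
apply: (meas3_comp mF).
- exact: measurableT_comp (mM _) (@measurable_proj11 R).
- exact: measurableT_comp (mM _) (@measurable_proj12 R).
- exact: measurableT_comp (mM _) (@measurable_proj2 R).
Qed.

End tetrahedron_integral.

(** * Convex functions on the unit interval *)

Section unit_interval.
Context {R : realType}.
Local Notation mu := (@lebesgue_measure R).
Local Notation I01 := (`[0%R, 1%R]%classic : set R).

Definition convex01 (h : R -> R) := forall u v l, 0 <= u <= 1 -> 0 <= v <= 1 ->
  0 <= l <= 1 -> h (l * u + (1 - l) * v) <= l * h u + (1 - l) * h v.

(** Strict sublevel sets of a convex function are intervals. An argument by continuity would fail at
    the endpoints, where [h] may jump. *)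
Lemma convex01_measurable (h : R -> R) : convex01 h -> measurable_fun I01 h.
Proof.
move=> ch mI; apply: (measurability _ (RGenInftyO.measurableE R)) => // _ [_ [c ->] <-].
apply: is_interval_measurable => x y /= [xI hx] [yI hy] z /andP[xz zy].
move: xI yI hx hy; rewrite /= !in_itv/= => xI yI hx hy.
have [xy|xy] := eqVneq x y; first by have -> : z = x by lra.
have yx : 0 < y - x by lra.
pose l := (y - z) / (y - x).
have l01 : 0 <= l <= 1 by rewrite /l ler_pdivlMr// ler_pdivrMr//; apply/andP; split; lra.
have zE : z = l * x + (1 - l) * y.
  by rewrite /l; field; rewrite gt_eqF.
split; first lra.
have := ch x y l xI yI l01; rewrite -zE => hz; apply: le_lt_trans hz _.
have [l0 l1] := andP l01; have [->|l0'] := eqVneq l 0; first lra.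
have : l * h x < l * c by rewrite ltr_pM2l// lt_neqAle eq_sym l0' l0.
have : (1 - l) * h y <= (1 - l) * c by rewrite ler_wpM2l ?subr_ge0// ltW.
lra.
Qed.

(** The chord bounds [h] from above. Since 1/2 is the midpoint of u and 1 - u, h u >= 2 h (1/2) - h
    (1 - u), and the upper bound at 1 - u yields the lower one at u. *)
Lemma convex01_bounded (h : R -> R) : convex01 h ->
  exists M, forall u, 0 <= u <= 1 -> `|h u| <= M.
Proof.
move=> ch; exists (2 * `|h (1 / 2)| + (`|h 0| + `|h 1|)).
have up u : 0 <= u <= 1 -> h u <= `|h 0| + `|h 1|.
  move=> u01; have l1 : 0 <= (1 : R) <= 1 by lra.
  have l0 : 0 <= (0 : R) <= 1 by lra.
  have := ch 1 0 u l1 l0 u01; rewrite mulr1 mulr0 addr0 => hu.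
  have a1 : u * h 1 <= `|h 1|.
    apply: le_trans (ler_norm _) _; rewrite normrM ger0_norm; last lra.
    by rewrite ler_piMl//; lra.
  have a0 : (1 - u) * h 0 <= `|h 0|.
    apply: le_trans (ler_norm _) _; rewrite normrM ger0_norm; last lra.
    by rewrite ler_piMl//; lra.
  lra.
move=> u u01; have u'01 : 0 <= 1 - u <= 1 by lra.
have := ch u (1 - u) (1 / 2) u01 u'01.
rewrite (_ : 1 / 2 * u + (1 - 1 / 2) * (1 - u) = 1 / 2); last by field.
have := up _ u01; have := up _ u'01; have := normr_ge0 (h (1 / 2)).
have := ler_norm (h (1 / 2)); have := ler_norm (- h (1 / 2)); rewrite normrN.
move=> ? ? ? ? ? cu; rewrite ler_norml; apply/andP; split; lra.
Qed.

Lemma lebesgue_measure01 : mu I01 = 1%:E.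
Proof. by rewrite lebesgue_measure_itv/= lte01 oppr0 adde0. Qed.

Lemma lebesgue_measure01_fin : (mu I01 < +oo)%E.
Proof. by rewrite lebesgue_measure01 ltry. Qed.

Lemma convex01_integrable (h : R -> R) : convex01 h ->
  mu.-integrable I01 (EFin \o h).
Proof.
move=> ch; apply: measurable_bounded_integrable => //.
- exact: lebesgue_measure01_fin.
- exact: convex01_measurable.
- have [M hM] := convex01_bounded ch; exists M; split; first exact: num_real.
  by move=> N MN u /= uI; apply: le_trans (ltW MN); apply: hM; rewrite in_itv in uI.
Qed.

(** Extension by 0 lets the integrals run over the whole line, where the substitution lemmas are
    stated; a large [M] makes the function nonnegative. *)
Definition shift01 (M : R) (h : R -> R) : R -> R := (fun u => h u + M) \_ I01.

Lemma shift01E M h u : 0 <= u <= 1 -> shift01 M h u = h u + M.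
Proof. by move=> uI; rewrite /shift01 patchE mem_set//= in_itv. Qed.

Lemma measurable_shift01 M h : convex01 h -> measurable_fun [set: R] (shift01 M h).
Proof.
move=> ch; apply/measurable_restrict => //; rewrite setTI.
by apply: measurable_funD => //; exact: convex01_measurable.
Qed.

Lemma shift01_ge0 M h u : (forall v, 0 <= v <= 1 -> - M <= h v) ->
  0 <= shift01 M h u.
Proof.
move=> hM; rewrite /shift01 patchE; case: ifP => //; rewrite mem_setE in_itv/= => uI.
by have := hM _ uI; lra.
Qed.

Lemma integral_shift01 M h : convex01 h ->
  (\int[mu]_u (shift01 M h u)%:E = (Rintegral mu I01 h + M)%:E)%E.
Proof.
move=> ch.
have iM : mu.-integrable I01 (EFin \o cst M).
  apply: measurable_bounded_integrable => //.
    exact: lebesgue_measure01_fin.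
  by exists `|M|; split => [|N MN u _ /=]; [exact: num_real|exact: ltW].
have ih := convex01_integrable ch.
transitivity (\int[mu]_(u in I01) ((h u)%:E + (cst M u)%:E))%E.
  rewrite [RHS]integral_mkcond; apply: eq_integral => u _.
  by rewrite patchE /shift01 patchE; case: (u \in _).
rewrite integralD//= EFinD; congr (_ + _)%E.
  by rewrite /Rintegral fineK//; exact: integrable_fin_num.
refine (etrans (integral_cst mu (measurable_itv _) M%:E) _).
by refine (etrans (congr1 (mule M%:E) lebesgue_measure01) (mule1 _)).
Qed.

Lemma integral_glue (p1 p2 : R -> R) :
  measurable_fun [set: R] p1 -> measurable_fun [set: R] p2 ->
  (forall u, 0 <= p1 u) -> (forall u, 0 <= p2 u) ->
  (\int[mu]_u (p1 (1 - 2 * u) + p2 (2 * u - 1))%:E =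
   (2^-1)%:E * (\int[mu]_u (p1 u)%:E + \int[mu]_u (p2 u)%:E))%E.
Proof.
move=> m1 m2 h1 h2.
have g0 (p : R -> R) (p0 : forall u, 0 <= p u) u : (0 <= (p u)%:E)%E by rewrite lee_fin.
have mE (p : R -> R) (mp : measurable_fun setT p) : measurable_fun setT (EFin \o p).
  exact/measurable_EFinP.
have ma : measurable_fun [set: R] (fun u : R => 2 * u + -1).
  by apply: measurable_funD => //; exact: measurable_funM.
have mp2 := measurableT_comp m2 ma.
have mp1n : measurable_fun [set: R] (fun u => p1 (- u)).
  by apply: (measurableT_comp m1); exact: oppr_measurable.
have mp1 := measurableT_comp mp1n ma.
transitivity (\int[mu]_u ((p1 (- (2 * u + -1)))%:E + (p2 (2 * u + -1))%:E))%E.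
  by apply: eq_integral => u _; rewrite EFinD; congr (_%:E + _)%E; congr p1; ring.
rewrite ge0_integralD//; last 4 first.
- by move=> x _; exact: (g0 _).
- exact: (mE _ mp1).
- by move=> x _; exact: (g0 _).
- exact: (mE _ mp2).
rewrite (integral_affine _ (h := fun u => (p1 (- u))%:E))//; last 2 first.
- exact: (mE _ mp1n).
- by move=> x; exact: (g0 _).
rewrite (integral_affine _ (h := fun u => (p2 u)%:E))//; last exact: (mE _ m2).
rewrite (integral_oppr (h := fun u => (p1 u)%:E)); last 2 first.
- exact: (mE _ m1).
- by move=> x; exact: (g0 _).
by apply/esym/ge0_muleDr; apply: integral_ge0 => x _; exact: g0.
Qed.

(** Meant for a main diagonal [h], with [h1] and [h2] its halves, both parametrised outwards from
    the centre. As [h] itself may fail to be convex, its integral is obtained from those of the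
    halves. *)
Lemma Rintegral_glue (h h1 h2 : R -> R) : convex01 h1 -> convex01 h2 ->
  (forall u, 0 <= u <= 1 / 2 -> h u = h1 (1 - 2 * u)) ->
  (forall u, 1 / 2 < u <= 1 -> h u = h2 (2 * u - 1)) ->
  Rintegral mu I01 h = (Rintegral mu I01 h1 + Rintegral mu I01 h2) / 2.
Proof.
move=> c1 c2 E1 E2.
have [M1 hM1] := convex01_bounded c1; have [M2 hM2] := convex01_bounded c2.
pose M := Num.max M1 M2.
have b1 v : 0 <= v <= 1 -> - M <= h1 v.
  move=> /hM1; rewrite ler_norml => /andP[+ _]; apply: le_trans.
  by rewrite lerN2 le_max lexx.
have b2 v : 0 <= v <= 1 -> - M <= h2 v.
  move=> /hM2; rewrite ler_norml => /andP[+ _]; apply: le_trans.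
  by rewrite lerN2 le_max lexx orbT.
pose p1 := shift01 M h1.
(* Removing 0 prevents the centre u = 1/2 from being counted in both halves, so that [HE] holds at
   every point. *)
pose p2 := shift01 M h2 \_ `]0%R, 1%R]%classic.
have p20 u : 0 <= p2 u by rewrite /p2 patchE; case: ifP => // _; exact: shift01_ge0.
have mp2 : measurable_fun [set: R] p2.
  apply/measurable_restrict => //; rewrite setTI.
  exact: measurable_funTS (measurable_shift01 M c2).
have HE u : 0 <= u <= 1 -> h u = p1 (1 - 2 * u) + p2 (2 * u - 1) - M.
  move=> u01; have [u12|u12] := leP u (1 / 2).
    rewrite E1; last lra.
    rewrite /p1 shift01E; last lra.
    rewrite /p2 patchE ifF; first by rewrite -[point]/(0 : R); ring.
    by rewrite mem_setE in_itv/=; apply/negP => /andP[? ?]; lra.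
  rewrite E2; last lra.
  have -> : p1 (1 - 2 * u) = 0.
    rewrite /p1 /shift01 patchE ifF//.
    by rewrite mem_setE in_itv/=; apply/negP => /andP[? ?]; lra.
  have -> : p2 (2 * u - 1) = h2 (2 * u - 1) + M.
    rewrite /p2 patchE ifT; last by rewrite mem_setE in_itv/=; lra.
    by rewrite shift01E; last lra.
  ring.
pose k u := p1 (1 - 2 * u) + p2 (2 * u - 1).
have k_out u : ~ (0 <= u <= 1) -> k u = 0.
  move=> uI; rewrite /k /p1 /p2 /shift01 !patchE !mem_setE !in_itv/=.
  rewrite ifF; last by apply/negP => /andP[? ?]; apply: uI; lra.
  by rewrite ifF -?[point]/(0 : R) ?addr0//; apply/negP => /andP[? ?]; apply: uI; lra.
have Ip2 : (\int[mu]_u (p2 u)%:E = (Rintegral mu I01 h2 + M)%:E)%E.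
  rewrite -integral_shift01//.
  transitivity (\int[mu]_(u in `]0%R, 1%R]) (shift01 M h2 u)%:E)%E.
    by rewrite [RHS]integral_mkcond; apply: eq_integral => u _; rewrite /p2 !patchE; case: ifP.
  rewrite integral_itv_obnd_cbnd; last first.
    by apply/measurable_EFinP; exact: measurable_funTS (measurable_shift01 M c2).
  rewrite integral_mkcond; apply: eq_integral => u _.
  by rewrite patchE /shift01 patchE; case: (u \in _).
have k0 u : 0 <= k u by rewrite addr_ge0// shift01_ge0.
have mp1 : measurable_fun [set: R] p1 by exact: measurable_shift01.
have mk : measurable_fun [set: R] k.
  apply: measurable_funD.
    apply: (measurableT_comp mp1 (g := fun u : R => 1 - 2 * u)).
    by apply: measurable_funB => //; exact: measurable_funM.
  apply: (measurableT_comp mp2 (g := fun u : R => 2 * u - 1)).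
  by apply: measurable_funB => //; exact: measurable_funM.
have Ik : (\int[mu]_(u in I01) (k u)%:E =
    ((Rintegral mu I01 h1 + Rintegral mu I01 h2) / 2 + M)%:E)%E.
  rewrite integral_mkcond.
  transitivity (\int[mu]_u (k u)%:E)%E.
    apply: eq_integral => u _; rewrite patchE mem_setE in_itv/=.
    by case: ifP => // /negP uI; rewrite k_out.
  rewrite integral_glue//; last by move=> u; exact: shift01_ge0.
  by rewrite integral_shift01// Ip2 -EFinD -EFinM; congr EFin; field.
have ik : mu.-integrable I01 (EFin \o k).
  apply/integrableP; split; first by apply/measurable_EFinP; exact: measurable_funTS.
  under eq_integral => u _ do rewrite /= ger0_norm//.
  by rewrite Ik ltry.
transitivity (Rintegral mu I01 (fun u => k u - cst M u)).
  by apply: eq_Rintegral => u; rewrite mem_setE in_itv/= => /HE.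
rewrite RintegralB//; last first.
  apply: measurable_bounded_integrable => //; first exact: lebesgue_measure01_fin.
  by exists `|M|; split => [|N MN u _ /=]; [exact: num_real|exact: ltW].
rewrite [X in X - _]/Rintegral Ik /=.
rewrite Rintegral_cst//= (_ : fine _ = 1) ?mulr1 ?addrK//.
by rewrite [X in fine X](_ : _ = 1%:E)//; exact: lebesgue_measure01.
Qed.

End unit_interval.

(** * The pyramids and tetrahedra in coordinates *)

Section coordinates.
Context {R : realType}.
Implicit Types (T : 'I_3 -> R) (g : ('I_3 -> R) -> R).

(** The cone from the origin over the face T i = 1 of [-1, 1]^3; the case j = i forces 0 <= T i. *)
Definition in_pyr (i : 'I_3) T : Prop := T i <= 1 /\ forall j, `|T j| <= T i.

Definition pyr_convex g := forall i T1 T2 l, in_pyr i T1 -> in_pyr i T2 ->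
  0 <= l <= 1 ->
  g (fun j => l * T1 j + (1 - l) * T2 j) <= l * g T1 + (1 - l) * g T2.

Definition flip (e : 'I_3 -> bool) g : ('I_3 -> R) -> R :=
  fun T => g (fun l => sgn R (e l) * T l).

Lemma cpt_convex (c : 'rV[R]_3) a e T1 T2 l :
  cpt c a e (fun j => l * T1 j + (1 - l) * T2 j) =
  l *: cpt c a e T1 + (1 - l) *: cpt c a e T2.
Proof.
rewrite /cpt !scalerDr addrACA -scalerDl subrKC scale1r; congr (_ + _).
rewrite !scalerA !scaler_sumr -big_split/=; apply: eq_bigr => j _.
by rewrite !scalerA -scalerDl; congr (_ *: _); ring.
Qed.

Lemma flip_pyr_convex (c : 'rV[R]_3) a e (f : 'rV[R]_3 -> R) (s : 'I_3 -> bool) :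
  (forall i b, convex_on (pyramid c a e i b) f) ->
  pyr_convex (flip s (fun T => f (cpt c a e T))).
Proof.
move=> cf i T1 T2 l T1i T2i l01; rewrite /flip.
have pyrE T : in_pyr i T -> pyramid c a e i (s i) (cpt c a e (fun j => sgn R (s j) * T j)).
  move=> [Ti1 TT]; have Ti0 : 0 <= T i by apply: le_trans (TT i).
  (* Radial projection to the face. If T i = 0, the point is the apex and any point of the face
     would do; the centre of the face is taken. *)
  pose X j := sgn R (s j) * (if T i == 0 then (j == i)%:R else T j / T i).
  exists (T i), (cpt c a e X); split; first by rewrite Ti0.
  split.
    exists X => //; split.
      by rewrite /X eqxx; case: eqVneq => [|Ti]; rewrite ?mulr1// divff// mulr1.
    move=> j; rewrite -ler_norml /X normrM [X in X * _](_ : _ = 1) ?mul1r; last first.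
      by rewrite /sgn; case: (s j); rewrite ?normrN normr1.
    case: eqVneq => [_|Ti]; first by case: (j == i); rewrite ?normr1 ?normr0.
    by rewrite normrM normfV [`|T i|]ger0_norm// ler_pdivrMr ?mul1r// lt_neqAle eq_sym Ti.
  have XE j : sgn R (s j) * T j = T i * X j.
    rewrite /X mulrCA; congr (_ * _); case: eqVneq => [Ti|Ti].
      by rewrite Ti mul0r; apply/eqP; rewrite -normr_le0 -Ti; exact: TT.
    by rewrite mulrC divfK.
  rewrite /cpt [c + _ - c]addrC addKr; congr (_ + _).
  rewrite !scalerA !scaler_sumr; apply: eq_bigr => j _; rewrite XE !scalerA.
  by congr (_ *: _); ring.
have := cf i (s i) _ _ l (pyrE _ T1i) (pyrE _ T2i) l01.
rewrite -cpt_convex; congr (f (cpt c a e _) <= _).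
by apply/funext => j; ring.
Qed.

(** The diagonal of P on the face T i = 1, starting at (1, 1, 1). *)
Definition fdiag (i : 'I_3) (u : R) : 'I_3 -> R := fun l => if l == i then 1 else 1 - 2 * u.

(** Half of a diagonal of Q, from the centre to the vertex adjacent to (1, 1, 1) in direction k. *)
Definition hdiag (k : 'I_3) (v : R) : 'I_3 -> R := fun l => if l == k then - v else v.

Lemma fdiag_in_pyr i u : 0 <= u <= 1 -> in_pyr i (fdiag i u).
Proof.
move=> u01; rewrite /in_pyr /fdiag eqxx; split => // j.
by case: ifP => _; rewrite ?normr1// ler_norml; lra.
Qed.

Lemma hdiag_in_pyr i k v : i != k -> 0 <= v <= 1 -> in_pyr i (hdiag k v).
Proof.
move=> ik v01; rewrite /in_pyr /hdiag (negbTE ik); split; first lra.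
by move=> j; case: ifP => _; rewrite ?normrN ger0_norm//; lra.
Qed.

Lemma ord3_neq (k : 'I_3) : exists i : 'I_3, i != k.
Proof.
case: k => [[|k] hk]; first by exists ord_max.
by exists ord0.
Qed.

Section pyr_convex.
Variables (g : ('I_3 -> R) -> R) (cg : pyr_convex g).

Lemma fdiag_convex01 i : convex01 (fun u => g (fdiag i u)).
Proof.
move=> u v l u01 v01 l01.
have := cg (fdiag_in_pyr i u01) (fdiag_in_pyr i v01) l01; congr (g _ <= _).
by apply/funext => j; rewrite /fdiag; case: ifP => _; ring.
Qed.

Lemma hdiag_convex01 k : convex01 (fun v => g (hdiag k v)).
Proof.
move=> u v l u01 v01 l01; have [i ik] := ord3_neq k.
have := cg (hdiag_in_pyr ik u01) (hdiag_in_pyr ik v01) l01; congr (g _ <= _).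
by apply/funext => j; rewrite /hdiag; case: ifP => _; ring.
Qed.

Definition in_tet (x y z : R) : Prop := [/\ x <= 1, y <= x, - x <= z & z <= y].

(* A point of the tetrahedron lies on a segment from the diagonal of the face
   to the half-diagonal of the cube; s is the barycentric weight of the former. *)
Lemma tet_convex t T : t \in perms3 -> in_tet (T t.1.1) (T t.1.2) (T t.2) ->
  let s := T t.1.1 + (T t.2 - T t.1.2) / 2 in
  let u := (T t.1.1 - T t.1.2) / 2 / s in
  let v := (T t.1.2 - T t.2) / 2 / (1 - s) in
  [/\ 0 <= s <= 1, 0 <= u <= 1, 0 <= v <= 1 &
    g T <= s * g (fdiag t.1.1 u) + (1 - s) * g (hdiag t.2 v)].
Proof.
move=> tP [x1 yx xz zy] s u v.
have s01 : 0 <= s <= 1 by rewrite /s; lra.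
(* At s = 0 the quotient u is 0 by convention, and the inequalities of [in_tet] force the right-hand
   side to be 0 as well; [sv] treats s = 1 likewise. *)
have su : s * u = (T t.1.1 - T t.1.2) / 2.
  have [s0|s0] := eqVneq s 0; last by rewrite /u mulrC divfK.
  by rewrite s0 mul0r; move: s0; rewrite /s; lra.
have sv : (1 - s) * v = (T t.1.2 - T t.2) / 2.
  have [s0|s0] := eqVneq (1 - s) 0; last by rewrite /v mulrC divfK.
  by rewrite s0 mul0r; move: s0; rewrite /s; lra.
have u01 : 0 <= u <= 1.
  have [s0|s0] := eqVneq s 0; first by rewrite /u s0 invr0 mulr0; lra.
  have sp : 0 < s by rewrite lt_neqAle eq_sym s0; case/andP: s01.
  by rewrite /u ler_pdivlMr// ler_pdivrMr// mul0r mul1r /s; lra.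
have v01 : 0 <= v <= 1.
  have [s0|s0] := eqVneq (1 - s) 0; first by rewrite /v s0 invr0 mulr0; lra.
  have sp : 0 < 1 - s by rewrite lt_neqAle eq_sym s0; lra.
  by rewrite /v ler_pdivlMr// ler_pdivrMr// mul0r mul1r /s; lra.
split => //.
have ik : t.1.1 != t.2.
  by move: tP; rewrite !in_cons in_nil orbF;
    move=> /orP[/eqP->|/orP[/eqP->|/orP[/eqP->|/orP[/eqP->|/orP[/eqP->|/eqP->]]]]].
have := cg (fdiag_in_pyr t.1.1 u01) (hdiag_in_pyr ik v01) s01; congr (g _ <= _).
apply/funext => l.
have E : s * fdiag t.1.1 u l + (1 - s) * hdiag t.2 v l =
    if l == t.1.1 then s + (1 - s) * v
    else if l == t.2 then s - 2 * (s * u) - (1 - s) * v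
    else s - 2 * (s * u) + (1 - s) * v.
  rewrite /fdiag /hdiag; case: (eqVneq l t.1.1) => [->|_].
    by rewrite (negbTE ik); ring.
  by case: ifP => _; ring.
rewrite E su sv.
have [lP jik] : [|| l == t.1.1, l == t.1.2 | l == t.2] /\
    (t.1.2 != t.1.1) && (t.1.2 != t.2).
  move: tP; rewrite !in_cons in_nil orbF;
    move=> /orP[/eqP->|/orP[/eqP->|/orP[/eqP->|/orP[/eqP->|/orP[/eqP->|/eqP->]]]]];
    by split => //; case: l {E} => [[|[|[|//]]] ?].
case/or3P: lP => /eqP ->.
- by rewrite eqxx /s; field.
- by case/andP: jik => /negbTE -> /negbTE ->; rewrite /s; field.
- by rewrite eq_sym (negbTE ik) eqxx /s; field.
Qed.

(** The weights s and 1 - s sum to 1, so raising both edge functions by [M] raises the convexity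
    bound by exactly [M]. *)
Lemma tet_le M t T : t \in perms3 -> in_tet (T t.1.1) (T t.1.2) (T t.2) ->
  g T + M <= tet (shift01 M (fun u => g (fdiag t.1.1 u)))
    (shift01 M (fun v => g (hdiag t.2 v))) (T t.1.1) (T t.1.2) (T t.2).
Proof.
move=> tP tT; have [s01 u01 v01 gT] := tet_convex tP tT.
move: s01 u01 v01 gT; rewrite /tet; set s := _ + _ / 2.
set b := (T t.1.2 - T t.2) / 2; set d := (T t.1.1 - T t.1.2) / 2 => s01 u01 v01 gT.
have bdP : [/\ 0 <= b, b <= 1 - s, 0 <= d & d <= s].
  by case: tT => *; rewrite /b /d /s; split; lra.
case: bdP => b0 bs d0 ds.
rewrite /cone ifT; last by apply/and3P; split => //; lra.
rewrite ifT; last by apply/and3P; split => //; lra.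
by rewrite !shift01E//; lra.
Qed.

(** The order of the two remaining coordinates tells on which side of the face diagonal the point
    lies. *)
Lemma in_pyr_tet i T : in_pyr i T ->
  exists2 t, t \in perms3 & in_tet (T t.1.1) (T t.1.2) (T t.2) /\ t.1.1 = i.
Proof.
move=> [Ti TT].
have in_tetP (j k : 'I_3) : T k <= T j -> in_tet (T i) (T j) (T k).
  by move: (TT j) (TT k); rewrite !ler_norml => /andP[? ?] /andP[? ?]; split; lra.
pose o n h : 'I_3 := @Ordinal 3 n h.
case: i {Ti TT} in_tetP => [[|[|[|//]]] hi] in_tetP.
- have [jk|jk] := leP (T (o 2%N isT)) (T (o 1%N isT)).
    exists (Ordinal hi, o 1%N isT, o 2%N isT) => //; split => //; exact: in_tetP.
  exists (Ordinal hi, o 2%N isT, o 1%N isT) => //; split => //; exact/in_tetP/ltW.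
- have [jk|jk] := leP (T (o 2%N isT)) (T (o 0%N isT)).
    exists (Ordinal hi, o 0%N isT, o 2%N isT) => //; split => //; exact: in_tetP.
  exists (Ordinal hi, o 2%N isT, o 0%N isT) => //; split => //; exact/in_tetP/ltW.
- have [jk|jk] := leP (T (o 1%N isT)) (T (o 0%N isT)).
    exists (Ordinal hi, o 0%N isT, o 1%N isT) => //; split => //; exact: in_tetP.
  exists (Ordinal hi, o 1%N isT, o 0%N isT) => //; split => //; exact/in_tetP/ltW.
Qed.

Lemma uniform_bound (I : finType) (U : Type) (P : U -> Prop) (h : I -> U -> R) :
  (forall i, exists M, forall u, P u -> `|h i u| <= M) ->
  exists M, forall i u, P u -> `|h i u| <= M.
Proof.
move=> /choice[M hM]; exists (\sum_i `|M i|) => i u Pu.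
apply: (le_trans (hM i u Pu)); apply: (le_trans (ler_norm _)).
by rewrite (bigD1 i)//= lerDl sumr_ge0.
Qed.

(** The bounds on the edges pass to the tetrahedra by [tet_convex], but only from above. Below, m i
    = T / 4 + 3 T' / 4 gives g T >= 4 g (m i) - 3 g T'. *)
Lemma pyr_convex_bounded : exists B, forall i T, in_pyr i T -> `|g T| <= B.
Proof.
have [B1 hB1] := uniform_bound (fun i => convex01_bounded (fdiag_convex01 i)).
have [B2 hB2] := uniform_bound (fun k => convex01_bounded (hdiag_convex01 k)).
(* With height 3/4 the reflected point has coordinate 1 - T i / 3 >= 2/3 in direction i, and the
   others are at most 1/3 in absolute value. *)
pose m (i : 'I_3) : 'I_3 -> R := fun l => if l == i then 3 / 4 else 0.
have [B3 hB3] : exists B, forall i, `|g (m i)| <= B.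
  by exists (\sum_i `|g (m i)|) => i; rewrite (bigD1 i)//= lerDl sumr_ge0.
pose B0 := `|B1| + `|B2|.
have B00 : 0 <= B0 by rewrite addr_ge0.
have up i T : in_pyr i T -> g T <= B0.
  move=> /in_pyr_tet[t tP [tT _]]; have [s01 u01 v01 gT] := tet_convex tP tT.
  apply: le_trans gT _; set s := _ + _ / 2 in s01 *.
  set x := g _; set y := g _.
  have xB : x <= B0.
    apply: le_trans (ler_norm _) _; apply: le_trans (hB1 _ _ u01) _.
    by apply: le_trans (ler_norm _) _; rewrite lerDl.
  have yB : y <= B0.
    apply: le_trans (ler_norm _) _; apply: le_trans (hB2 _ _ v01) _.
    by apply: le_trans (ler_norm _) _; rewrite lerDr.
  have : s * x <= s * B0 by rewrite ler_wpM2l//; case/andP: s01.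
  have : (1 - s) * y <= (1 - s) * B0 by rewrite ler_wpM2l//; lra.
  lra.
exists (4 * `|B3| + 3 * B0) => i T iT.
(* The reflection of T in a ratio 1/3 about the interior point m i stays in the pyramid. *)
pose T' := fun l => m i l + (m i l - T l) / 3.
have iT' : in_pyr i T'.
  have [Ti TT] := iT; rewrite /in_pyr /T' /m eqxx; split.
    by have := TT i; rewrite ler_norml => /andP[? ?]; lra.
  move=> j; have := TT i; have := TT j; rewrite !ler_norml => /andP[? ?] /andP[? ?].
  by case: eqP => [->|_]; lra.
have q14 : 0 <= (1 / 4 : R) <= 1 by lra.
have := cg iT iT' q14.
rewrite (_ : (fun j => _) = m i); last by apply/funext => j; rewrite /T'; field.
have := up _ _ iT; have := up _ _ iT'; have := hB3 i; rewrite ler_norml.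
have := ler_norm B3; have := normr_ge0 B3.
by move=> ? ? /andP[? ?] ? ? ?; rewrite ler_norml; lra.
Qed.

End pyr_convex.

(** A coordinate of largest absolute value selects the pair of opposite faces, and its sign decides
    between the one through V and the one through W. *)
Lemma sign_tet (x : 'I_3 -> R) : (forall l, `|x l| <= 1) ->
  exists b, exists2 t, t \in perms3 &
    in_tet (sgn R b * x t.1.1) (sgn R b * x t.1.2) (sgn R b * x t.2) /\
    in_pyr t.1.1 (fun l => sgn R b * x l).
Proof.
move=> x1; have [i _ xi] := @Order.TotalTheory.arg_maxP _ _ 'I_3 ord0 predT (fun l => `|x l|) isT.
exists (0 <= x i); set e := sgn R _.
have ei : e * x i = `|x i|.
  rewrite /e /sgn; case: leP => x0; first by rewrite mul1r ger0_norm.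
  by rewrite mulN1r ltr0_norm.
have e1 : `|e| = 1 by rewrite /e /sgn; case: ifP; rewrite ?normrN normr1.
have iP : in_pyr i (fun l => e * x l).
  split; first by rewrite ei.
  by move=> j; rewrite ei normrM e1 mul1r; exact: xi.
by have [t tP [tT tE]] := in_pyr_tet iP; exists t => //; split => //; rewrite tE.
Qed.

End coordinates.

(** * The averages over P and Q as means over six edges *)

Section segments.
Context {R : realType}.
Variables (c : 'rV[R]_3) (a : R) (e : 'I_3 -> 'rV[R]_3) (f : 'rV[R]_3 -> R).
Hypotheses (a0 : 0 < a) (ef : orthonormal_frame e).
Hypothesis cf : forall i b, convex_on (pyramid c a e i b) f.
Local Notation mu := (@lebesgue_measure R).
Local Notation I01 := (`[0%R, 1%R]%classic : set R).
Implicit Types (s t : {ffun 'I_3 -> bool}).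

Let g s := flip s (fun T => f (cpt c a e T)).

Lemma dotZl k (u v : 'rV[R]_3) : dot (k *: u) v = k * dot u v.
Proof. by rewrite /dot -scalemxAl mxE. Qed.

Lemma dotC (u v : 'rV[R]_3) : dot u v = dot v u.
Proof. by rewrite /dot !mxE; apply: eq_bigr => i _; rewrite !mxE mulrC. Qed.

Lemma dot_suml (d : 'I_3 -> R) v : dot (\sum_j d j *: e j) v = \sum_j d j * dot (e j) v.
Proof.
rewrite /dot mulmx_suml summxE; apply: eq_bigr => j _.
by rewrite -scalemxAl mxE.
Qed.

Lemma len_cpt X Y : len (cpt c a e Y - cpt c a e X) =
  a * Num.sqrt (\sum_j (Y j - X j) ^+ 2).
Proof.
have -> : cpt c a e Y - cpt c a e X = a *: \sum_j (Y j - X j) *: e j.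
  rewrite /cpt opprD addrACA subrr add0r -scalerBr -sumrB; congr (_ *: _).
  by apply: eq_bigr => j _; rewrite scalerBl.
rewrite /len dotZl dotC dotZl mulrA -expr2 sqrtrM ?sqr_ge0// sqrtr_sqr gtr0_norm//.
congr (_ * Num.sqrt _); rewrite dot_suml; apply: eq_bigr => j _.
rewrite dotC dot_suml (bigD1 j)//= ef eqxx mulr1 big1 ?addr0 ?expr2// => k kj.
by rewrite ef (negbTE kj) mulr0.
Qed.

Lemma avg_seg_cpt X Y : avg_seg f (cpt c a e X) (cpt c a e Y) =
  Rintegral mu I01 (fun u => f (cpt c a e (fun j => X j + u * (Y j - X j)))).
Proof.
apply: eq_Rintegral => u _; congr f; rewrite /cpt opprD addrACA subrr add0r.
rewrite -addrA; congr (_ + _); rewrite -scalerBr scalerA mulrC -scalerA -scalerDr.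
congr (_ *: _); rewrite -sumrB scaler_sumr -big_split/=; apply: eq_bigr => j _.
by rewrite -scalerBl scalerA -scalerDl.
Qed.

(* The other endpoint of the diagonal from [s] of the face orthogonal to direction [i]. *)
Definition flip_others s i : {ffun 'I_3 -> bool} := [ffun j => (j == i) == s j].

Lemma hammingE s t : hamming s t = #|finset (fun j => s j != t j)|.
Proof. by apply: eq_card => j; rewrite [RHS]finset.in_set; apply/idP/idP => [/set_mem//|st]; exact: mem_set. Qed.

(** Two vertices at distance 2 agree in exactly one coordinate, which names their common face; [h']
    recovers it. *)
Lemma sum_hamming2 (F : {ffun 'I_3 -> bool} -> R) s :
  \sum_(t | hamming s t == 2%N) F t = \sum_i F (flip_others s i).
Proof.
pose h' t := odflt ord0 [pick j | s j == t j].
rewrite (reindex_onto (flip_others s) h'); last first.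
  move=> t /eqP st2.
  have /eqP/cards1P[i Hi] : #|~: finset (fun j => s j != t j)| = 1%N.
    have : (hamming s t + #|~: finset (fun j => s j != t j)| = 3)%N.
      by rewrite hammingE cardsC card_ord.
    by rewrite st2 => -[].
  have Hj j : (s j == t j) = (j == i) by rewrite -finset.in_set1 -Hi finset.in_setC finset.in_set negbK.
  have -> : h' t = i.
    rewrite /h'; case: pickP => [j|/(_ i)]; rewrite Hj; first by move/eqP.
    by rewrite eqxx.
  by apply/ffunP => j; rewrite ffunE -Hj; case: (s j); case: (t j).
apply: eq_bigl => i; apply/andP; split.
  rewrite hammingE (_ : finset _ = [set~ i]%SET) ?cardsC1 ?card_ord//.
  by apply/finset.setP => j; rewrite finset.in_setC1 finset.in_set ffunE; case: (j == i); case: (s j).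
rewrite /h'; case: pickP => [j|/(_ i)]; rewrite ffunE.
  by rewrite /=; case: (j == i); case: (s j).
by rewrite eqxx; case: (s i).
Qed.

Lemma vertex_flip_others s i u :
  f (cpt c a e (fun j => sgn R (s j) + u * (sgn R (flip_others s i j) - sgn R (s j)))) =
  g s (fdiag i u).
Proof.
rewrite /g /flip; congr (f (cpt c a e _)); apply/funext => j; rewrite ffunE /fdiag.
by case: (j == i); case: (s j); rewrite /sgn /=; ring.
Qed.

Lemma avg_segs_P s : avg_segs f (P_segs c a e s) =
  (\sum_i Rintegral mu I01 (fun u => g s (fdiag i u)) +
   \sum_i Rintegral mu I01 (fun u => g (opp_sign s) (fdiag i u))) / 6.
Proof.
(* Two coordinates change by 2, and 8 = 2 * 2 ^ 2. Equal lengths turn the weighted mean into a plain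
   one. *)
pose L := a * Num.sqrt 8.
have L0 : 0 < L by rewrite mulr_gt0// sqrtr_gt0.
have lenL s' i : len (vertex c a e (flip_others s' i) - vertex c a e s') = L.
  rewrite /vertex len_cpt; congr (_ * Num.sqrt _).
  rewrite (bigD1 i)//= ffunE eqxx /= subrr expr0n add0r.
  rewrite (eq_bigr (fun=> 4)) => [|j ji].
    by rewrite sumr_const (_ : #|_| = 2%N) ?cardC1 ?card_ord//; ring.
  by rewrite ffunE (negbTE ji); case: (s' j); rewrite /sgn /=; ring.
have avgE s' i : avg_seg f (vertex c a e s') (vertex c a e (flip_others s' i)) =
    Rintegral mu I01 (fun u => g s' (fdiag i u)).
  rewrite /vertex avg_seg_cpt; apply: eq_Rintegral => u _; exact: vertex_flip_others.
have H s' (F : 'rV[R]_3 * 'rV[R]_3 -> R) :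
    \sum_(x <- [seq (vertex c a e s', vertex c a e t) |
      t <- enum {ffun 'I_3 -> bool} & hamming s' t == 2%N]) F x =
    \sum_i F (vertex c a e s', vertex c a e (flip_others s' i)).
  rewrite big_map big_filter big_enum_cond /=.
  exact: (sum_hamming2 (fun t => F (vertex c a e s', vertex c a e t))).
rewrite /avg_segs /P_segs !big_cat !H /=.
under eq_bigr do rewrite lenL avgE.
under [X in _ + X]eq_bigr do rewrite lenL avgE.
under [X in _ / (X + _)]eq_bigr do rewrite lenL.
under [X in _ / (_ + X)]eq_bigr do rewrite lenL.
have -> : \sum_(i < 3) L = L * 3 by rewrite sumr_const card_ord mulr_natr.
by rewrite -!mulr_sumr; field; rewrite gt_eqF//; lra.
Qed.

(* The endpoint [t] with [t 0 = ~~ s 0] of the main diagonal through the vertices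
   that differ from [s] or its opposite only in coordinate [k]. *)
Definition Q_vertex s k : {ffun 'I_3 -> bool} :=
  if k == ord0 then opp_sign (flip_others s k) else flip_others s k.

Lemma sum_Q_vertex (F : {ffun 'I_3 -> bool} -> R) s :
  \sum_(t | (t != s) && (t != opp_sign s) && (t ord0 == ~~ s ord0)) F t =
  \sum_k F (Q_vertex s k).
Proof.
pose o n h : 'I_3 := @Ordinal 3 n h.
have o0E : o 0%N isT = ord0 by exact: val_inj.
have neq_ffun (t t' : {ffun 'I_3 -> bool}) j : t j != t' j -> t != t'.
  by apply: contra_neq => ->.
have fext (t t' : {ffun 'I_3 -> bool}) : t ord0 = t' ord0 ->
    t (o 1%N isT) = t' (o 1%N isT) -> t (o 2%N isT) = t' (o 2%N isT) -> t = t'.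
  move=> e0 e1 e2; apply/ffunP => -[[|[|[|//]]] hj].
  - by rewrite (_ : Ordinal hj = ord0)//; exact: val_inj.
  - by rewrite (_ : Ordinal hj = o 1%N isT)//; exact: val_inj.
  - by rewrite (_ : Ordinal hj = o 2%N isT)//; exact: val_inj.
(* Inverse of [Q_vertex]: [t] differs from [s] at 0 and is not its opposite, so it agrees with [s]
   at 1 or at 2. A single agreement gives k, a double one means k = 0. *)
pose h' t := if t (o 1%N isT) != s (o 1%N isT) then o 2%N isT
  else if t (o 2%N isT) != s (o 2%N isT) then o 1%N isT else ord0.
have QE k j : Q_vertex s k j = ((k == ord0) (+) ((j == k) == s j)).
  by rewrite /Q_vertex; case: (k == ord0); rewrite !ffunE//= ?addTb ?ffunE.
rewrite (reindex_onto (Q_vertex s) h'); last first.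
  move=> t /andP[/andP[ts tos] /eqP t0].
  have {}tos : (t (o 1%N isT) == s (o 1%N isT)) || (t (o 2%N isT) == s (o 2%N isT)).
    apply: contraNT tos; rewrite negb_or => /andP[e1 e2]; apply/eqP.
    apply: fext; rewrite ffunE //.
    - by move: e1; case: (t _); case: (s _).
    - by move: e2; case: (t _); case: (s _).
  apply: fext; rewrite QE /h'; move: t0 tos; rewrite -!o0E;
    by case: (t (o 0%N isT)); case: (t (o 1%N isT)); case: (t (o 2%N isT));
       case: (s (o 0%N isT)); case: (s (o 1%N isT)); case: (s (o 2%N isT)).
apply: eq_bigl => k.
apply/andP; split; last first.
  rewrite /h' !QE; case: k => [[|[|[|//]]] hk];
    by case: (s (o 1%N isT)); case: (s (o 2%N isT)).
apply/andP; split; last first.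
  by rewrite QE [k == _]eq_sym; case: (ord0 == k); case: (s ord0).
apply/andP; split.
  by apply: (neq_ffun _ _ ord0); rewrite QE [k == _]eq_sym; case: (ord0 == k); case: (s ord0).
apply: (neq_ffun _ _ (if k == ord0 then o 1%N isT else k)).
rewrite QE ffunE; case: (boolP (k == ord0)) => [/eqP ->|_] /=; first by case: (s _).
by rewrite eqxx; case: (s k).
Qed.

(** The endpoints of the diagonal are adjacent to V and to W in direction k, so one half is an
    [hdiag] in the signs of [s], the other in the opposite signs. *)
Lemma avg_Q_vertex s k :
  avg_seg f (vertex c a e (Q_vertex s k)) (vertex c a e (opp_sign (Q_vertex s k))) =
  (Rintegral mu I01 (fun v => g s (hdiag k v)) +
   Rintegral mu I01 (fun v => g (opp_sign s) (hdiag k v))) / 2.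
Proof.
have cg s' : convex01 (fun v => g s' (hdiag k v)).
  exact: hdiag_convex01 (flip_pyr_convex s' cf) k.
rewrite /vertex avg_seg_cpt.
have gE s' (r v : R) : (forall j, sgn R (Q_vertex s k j) * r = sgn R (s' j) * hdiag k v j) ->
    f (cpt c a e (fun j => sgn R (Q_vertex s k j) * r)) = g s' (hdiag k v).
  by move=> H; rewrite /g /flip; congr (f (cpt c a e _)); apply/funext.
have sgnN b : sgn R (~~ b) = - sgn R b by case: b; rewrite /sgn /= ?opprK.
have path u : (fun j => sgn R (Q_vertex s k j) + u * (sgn R (opp_sign (Q_vertex s k) j) -
    sgn R (Q_vertex s k j))) = (fun j => sgn R (Q_vertex s k j) * (1 - 2 * u)).
  by apply/funext => j; rewrite [in X in X - _]ffunE sgnN; ring.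
under eq_Rintegral do rewrite path.
have [k0|k0] := boolP (k == ord0).
  apply: Rintegral_glue (cg _) (cg _) _ _ => u u01; apply: gE => j.
    by rewrite /Q_vertex k0 !ffunE /hdiag; case: (j == k); case: (s j); rewrite /sgn /=; ring.
  by rewrite /Q_vertex k0 !ffunE /hdiag; case: (j == k); case: (s j); rewrite /sgn /=; ring.
(* For k other than 0 the listed endpoint is adjacent to the vertex opposite to [s], so the halves
   appear in reverse order. *)
rewrite addrC; apply: Rintegral_glue (cg _) (cg _) _ _ => u u01; apply: gE => j.
  by rewrite /Q_vertex (negbTE k0) !ffunE /hdiag; case: (j == k); case: (s j); rewrite /sgn /=; ring.
by rewrite /Q_vertex (negbTE k0) !ffunE /hdiag; case: (j == k); case: (s j); rewrite /sgn /=; ring.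
Qed.

Lemma avg_segs_Q s : avg_segs f (Q_segs c a e s) =
  (\sum_k Rintegral mu I01 (fun v => g s (hdiag k v)) +
   \sum_k Rintegral mu I01 (fun v => g (opp_sign s) (hdiag k v))) / 6.
Proof.
pose L := a * Num.sqrt 12.
have L0 : 0 < L by rewrite mulr_gt0// sqrtr_gt0.
have lenL t : len (vertex c a e (opp_sign t) - vertex c a e t) = L.
  rewrite /vertex len_cpt; congr (_ * Num.sqrt _).
  rewrite (eq_bigr (fun=> 4)) => [|j _].
    by rewrite sumr_const card_ord; ring.
  by rewrite ffunE; case: (t j); rewrite /sgn /=; ring.
have H (F : 'rV[R]_3 * 'rV[R]_3 -> R) : \sum_(x <- Q_segs c a e s) F x =
    \sum_k F (vertex c a e (Q_vertex s k), vertex c a e (opp_sign (Q_vertex s k))).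
  rewrite big_map big_filter big_enum_cond /=.
  exact: (sum_Q_vertex (fun t => F (vertex c a e t, vertex c a e (opp_sign t)))).
rewrite /avg_segs !H /=.
under eq_bigr do rewrite lenL avg_Q_vertex.
under [X in _ / X]eq_bigr do rewrite lenL.
have -> : \sum_(i < 3) L = L * 3 by rewrite sumr_const card_ord mulr_natr.
rewrite -mulr_sumr -mulr_suml big_split /=; field.
by rewrite gt_eqF.
Qed.

End segments.

(** * The majorant on the cube and the conclusion *)

Section main.
Context {R : realType}.
Local Notation mu := (@lebesgue_measure R).
Local Notation mu3 := ((mu \x mu) \x mu)%E.
Local Notation I01 := (`[0%R, 1%R]%classic : set R).
Local Notation J := (`[-1%R, 1%R]%classic : set R).
Local Notation C := (J `*` J `*` J).

(* Both sides are suprema of integrals of simple functions, so no measurability is needed. *)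
Lemma le_integral_nonmeas d (T : measurableType d) (m : {measure set T -> \bar R})
    (D : set T) (f1 f2 : T -> \bar R) :
  (forall x, D x -> f1 x <= f2 x)%E ->
  (\int[m]_(x in D) f1 x <= \int[m]_(x in D) f2 x)%E.
Proof.
have ge0 h1 h2 : (forall x, D x -> 0 <= h1 x)%E -> (forall x, D x -> 0 <= h2 x)%E ->
    (forall x, D x -> h1 x <= h2 x)%E ->
    (\int[m]_(x in D) h1 x <= \int[m]_(x in D) h2 x)%E.
  move=> h10 h20 h12; rewrite !ge0_integralE//.
  apply: le_ereal_sup => _ [h hh <-]; exists h => // x.
  apply: le_trans (hh x) _; rewrite !patchE; case: ifP => // xD.
  by apply: h12; rewrite inE in xD.
move=> f12; rewrite integralE [leRHS]integralE; apply: leeB; apply: ge0 => x Dx;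
  rewrite ?funepos_ge0 ?funeneg_ge0//.
- by rewrite !funeposE ge_max !le_max f12//= lexx orbT.
- by rewrite !funenegE ge_max !le_max leeN2 f12//= lexx orbT.
Qed.

Lemma measurable_cube : measurable (C : set (R * R * R)).
Proof. by apply: measurableX; [apply: measurableX|]; exact: measurable_itv. Qed.

Lemma measure_cube : mu3 C = 8%:E.
Proof.
have mJ : measurable J by exact: measurable_itv.
have muJ : mu J = 2%:E.
  by rewrite lebesgue_measure_itv/= lte_fin ifT -?EFinB; [congr EFin|]; lra.
have muJJ : (mu \x mu)%E (J `*` J) = 4%:E.
  refine (etrans (product_measure1E mu mu mJ mJ) _).
  by refine (etrans (congr2 mule muJ muJ) _); rewrite -EFinM; congr EFin; lra.
refine (etrans (product_measure1E (mu \x mu)%E mu (measurableX mJ mJ) mJ) _).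
by refine (etrans (congr2 mule muJJ muJ) _); rewrite -EFinM; congr EFin; lra.
Qed.

Definition tets : seq (bool * ('I_3 * 'I_3 * 'I_3)) :=
  [seq (b, t) | b <- [:: true; false], t <- perms3].

(** The factor 2 counts the two orders (i, j, k) with a given i, and likewise the two with a given
    k. *)
Lemma sum_tets (A B : bool -> 'I_3 -> R) :
  \sum_(x <- tets) (A x.1 x.2.1.1 + B x.1 x.2.2) =
  2 * (\sum_i A true i + \sum_i A false i + (\sum_k B true k + \sum_k B false k)).
Proof.
have sum3 (F : 'I_3 -> R) : \sum_i F i = F (Ordinal (isT : 0 < 3)%N) +
    (F (Ordinal (isT : 1 < 3)%N) + F (Ordinal (isT : 2 < 3)%N)).
  rewrite !big_ord_recl big_ord0 addr0.
  by congr (F _ + (F _ + F _)); exact: val_inj.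
by rewrite !sum3 /tets /perms3 /= !big_cons big_nil /=; ring.
Qed.

(** The hypothesis on [s] makes [s false] the opposite sign vector of [s true]: the two frames
    belong to V and W. *)
Lemma le_avg_cube (f : 'rV[R]_3 -> R) (c : 'rV[R]_3) (a : R) (e : 'I_3 -> 'rV[R]_3)
    (s : bool -> 'I_3 -> bool) :
  (forall b l, s b l = (s true l == b)) ->
  (forall i b, convex_on (pyramid c a e i b) f) ->
  let g b := flip (s b) (fun T => f (cpt c a e T)) in
  avg_cube c a e f <=
  1 / 12 * (\sum_i Rintegral mu I01 (fun u => g true (fdiag i u)) +
            \sum_i Rintegral mu I01 (fun u => g false (fdiag i u)) +
           (\sum_k Rintegral mu I01 (fun v => g true (hdiag k v)) +
            \sum_k Rintegral mu I01 (fun v => g false (hdiag k v)))).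
Proof.
move=> sE cf; cbv zeta; set g := fun b : bool => flip (s b) _.
have cg b : pyr_convex (g b) by exact: flip_pyr_convex.
have [M hM] : exists M, forall b i T, in_pyr i T -> `|g b T| <= M.
  have [B1 h1] := pyr_convex_bounded (cg true).
  have [B2 h2] := pyr_convex_bounded (cg false).
  exists (Num.max B1 B2) => b i T iT; rewrite le_max.
  by case: b; [rewrite (h1 i)|rewrite (h2 i)// orbT].
pose A b i := Rintegral mu I01 (fun u => g b (fdiag i u)).
pose B b k := Rintegral mu I01 (fun v => g b (hdiag k v)).
pose p b i := shift01 M (fun u => g b (fdiag i u)).
pose q b k := shift01 M (fun v => g b (hdiag k v)).
have cp b i := fdiag_convex01 (cg b) i.
have cq b k := hdiag_convex01 (cg b) k.
have p0 b i u : 0 <= p b i u.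
  apply: shift01_ge0 => v v01; have := hM b i _ (fdiag_in_pyr i v01).
  by rewrite ler_norml => /andP[].
have q0 b k u : 0 <= q b k u.
  have [i ik] := ord3_neq k.
  apply: shift01_ge0 => v v01; have := hM b i _ (hdiag_in_pyr ik v01).
  by rewrite ler_norml => /andP[].
have mp b i : measurable_fun [set: R] (p b i) by exact: measurable_shift01.
have mq b k : measurable_fun [set: R] (q b k) by exact: measurable_shift01.
pose X b (z : R * R * R) l := sgn R (s b l) * crd z l.
pose H (x : bool * ('I_3 * 'I_3 * 'I_3)) (z : R * R * R) : R :=
  tet (p x.1 x.2.1.1) (q x.1 x.2.2) (X x.1 z x.2.1.1) (X x.1 z x.2.1.2) (X x.1 z x.2.2).
(* All terms are nonnegative and the tetrahedra cover the cube, so at each point the sum dominates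
   the bound from a tetrahedron containing it. *)
pose G z := \sum_(x <- tets) H x z.
have H0 x z : 0 <= H x z by exact: tet_ge0.
have mX b l : measurable_fun [set: R * R * R] (fun z => X b z l).
  by apply: measurable_funM => //; exact: measurable_crd.
have mH x : measurable_fun [set: R * R * R] (fun z => (H x z)%:E).
  exact: (meas3_comp (meas3_tet (mp _ _) (mq _ _))).
have IH x : x.2 \in perms3 -> (\int[mu3]_z (H x z)%:E =
    (3^-1 * ((A x.1 x.2.1.1 + M) + (B x.1 x.2.2 + M)))%:E)%E.
  move=> xP.
  refine (etrans (integral_leb3_signed_perm (s x.1) xP
    (meas3_tet (mp x.1 x.2.1.1) (mq x.1 x.2.2)) _) _).
    by move=> *; rewrite lee_fin tet_ge0.
  by rewrite int3_tet// !integral_shift01.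
(* Twelve tetrahedra with two edges each contribute 24 M / 3 = 8 M, the volume of the cube times the
   shift. *)
have IG : (\int[mu3]_z (G z)%:E = (3^-1 * (2 *
    (\sum_i A true i + \sum_i A false i + (\sum_k B true k + \sum_k B false k))) + 8 * M)%:E)%E.
  under eq_integral do rewrite -sumEFin.
  rewrite ge0_integral_sum//; last by move=> x z _; rewrite lee_fin.
  transitivity (\sum_(x <- tets) (3^-1 * ((A x.1 x.2.1.1 + M) + (B x.1 x.2.2 + M)))%:E)%E.
    rewrite big_seq [RHS]big_seq; apply: eq_bigr => -[b t] /allpairsP[[b' t'] [_ t'P [-> ->]]].
    exact: IH.
  rewrite sumEFin -mulr_sumr (sum_tets (fun b i => A b i + M) (fun b k => B b k + M)).
  rewrite !big_split /= !sumr_const card_ord; congr EFin; by field.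
have cov z : C z -> exists b, exists2 t, t \in perms3 &
    in_tet (X b z t.1.1) (X b z t.1.2) (X b z t.2) /\ in_pyr t.1.1 (X b z).
  move=> zC; have z1 l : `|X true z l| <= 1.
    rewrite /X normrM (_ : `|sgn R _| = 1) ?mul1r; last first.
      by rewrite /sgn; case: (s _ _); rewrite ?normrN normr1.
    case: z zC => [[z1 z2] z3] /= [[]]; rewrite /= !in_itv/= /crd /=.
    by move=> ? ? ?; rewrite ler_norml; case: ifP => _ //; case: ifP.
  have [b [t tP tT]] := sign_tet z1; exists b, t => //.
  suff -> : X b z = fun l => sgn R b * X true z l by [].
  apply/funext => l; rewrite /X (sE b) mulrA; congr (_ * _).
  by clear; case: b; case: (s true l); rewrite /sgn /= ?mulN1r ?mul1r ?opprK.
pose F z := f (cpt c a e (crd z)).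
have FX b z : F z = g b (X b z).
  rewrite /F /g /flip /X; congr (f (cpt c a e _)); apply/funext => l.
  by rewrite mulrA /sgn; case: (s b l); rewrite ?mulrNN !mul1r.
have in_tets b t : t \in perms3 -> (b, t) \in tets.
  by move=> tP; apply/allpairsP; exists (b, t); split => //; case: b.
have FG z : C z -> F z <= G z - M.
  move=> /cov[b [t tP [tT _]]]; rewrite lerBrDr (FX b).
  apply: le_trans (tet_le (cg b) M tP tT) _.
  by rewrite /G (big_rem _ (in_tets b t tP))/= lerDl sumr_ge0.
have FM z : C z -> - M <= F z.
  move=> /cov[b [t tP [_ tX]]]; rewrite (FX b).
  by have := hM b _ _ tX; rewrite ler_norml => /andP[].
have mC := measurable_cube.
have mG : measurable_fun [set: R * R * R] (EFin \o G).
  rewrite (_ : _ \o _ = fun z => \sum_(x <- tets) (H x z)%:E)%E.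
    by apply: emeasurable_sum => x; exact: mH.
  by apply/funext => z; rewrite /= -sumEFin.
have G0 z : (0 <= (G z)%:E)%E by rewrite lee_fin sumr_ge0.
have ICG : (\int[mu3]_(z in C) (G z)%:E <= \int[mu3]_z (G z)%:E)%E.
  exact: ge0_subset_integral.
have iG : mu3.-integrable C (EFin \o G).
  apply/integrableP; split; first exact: measurable_funTS.
  under eq_integral => z _ do rewrite /= ger0_norm -?lee_fin//.
  by apply: le_lt_trans ICG _; rewrite IG ltry.
have iM : mu3.-integrable C (EFin \o cst M).
  apply: measurable_bounded_integrable => //.
    by rewrite [X in (X < _)%E](_ : _ = 8%:E) ?ltry//; exact: measure_cube.
  by exists `|M|; split => [|N MN u _ /=]; [exact: num_real|exact: ltW].
have cstC k : (\int[mu3]_(z in C) k%:E = (k * 8)%:E)%E.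
  by refine (etrans (integral_cst mu3 mC k%:E) _); rewrite EFinM; congr (_ * _)%E; exact: measure_cube.
set S := \sum_i A true i + _ + _ in IG *.
have up : (\int[mu3]_(z in C) (F z)%:E <= (2 / 3 * S)%:E)%E.
  apply: (@le_trans _ _ (\int[mu3]_(z in C) ((G z)%:E - (cst M z)%:E)))%E.
    by apply: le_integral_nonmeas => z /FG; rewrite -EFinB lee_fin.
  rewrite integralB_EFin// cstC.
  apply: (@le_trans _ _ (\int[mu3]_z (G z)%:E - (M * 8)%:E))%E; first exact: leeB.
  by rewrite IG -EFinB lee_fin; lra.
have lo : ((- M * 8)%:E <= \int[mu3]_(z in C) (F z)%:E)%E.
  by rewrite -cstC; apply: le_integral_nonmeas => z /FM; rewrite lee_fin.
(* [Rintegral] sends infinite values to 0; the bound transfers to it once the extended integral is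
   known to be finite. *)
have fI : (\int[mu3]_(z in C) (F z)%:E)%E \is a fin_num.
  by rewrite fin_numElt (lt_le_trans _ lo) ?ltNyr// (le_lt_trans up) ?ltry.
have : Rintegral mu3 C F <= 2 / 3 * S by rewrite -lee_fin fineK.
rewrite /avg_cube -[Rintegral _ _ _]/(Rintegral mu3 C F); lra.
Qed.

End main.

Unset Implicit Arguments.

Theorem theorem8p1 (R : realType) (c : 'rV[R]_3) (a : R) (e : 'I_3 -> 'rV[R]_3)
  (f : 'rV[R]_3 -> R) (s0 : {ffun 'I_3 -> bool}) :
  0 < a -> orthonormal_frame e ->
  (forall (i : 'I_3) (b : bool), convex_on (pyramid c a e i b) f) ->
  avg_cube c a e f <=
    (1 / 2) * avg_segs f (P_segs c a e s0) + (1 / 2) * avg_segs f (Q_segs c a e s0).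
Proof.
move=> a0 ef cf.
pose s (b : bool) : 'I_3 -> bool := if b then s0 else opp_sign s0.
have sE b l : s b l = (s true l == b) by case: b; rewrite /s ?ffunE; case: (s0 l).
apply: le_trans (le_avg_cube sE cf) _.
by rewrite avg_segs_P// avg_segs_Q//; lra.
Qed.
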